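(* Let $0<\alpha<n$, $p=1$, $q=n/(n-\alpha)$ and $w\in A_{1,q}$. Assume that $\theta$ satisfies the $\mathcal D_\kappa$ condition with $0\le\kappa<1/q$. Then the fractional integral operator $I_\alpha$ is bounded from $\mathcal M^{1,\theta}(w,w^q)$ into $W\mathcal M^{q,\theta^q}(w^q)$; that is, there is a constant $C>0$ such that $\|I_\alpha f\|_{W\mathcal M^{q,\theta^q}(w^q)}\le C\|f\|_{\mathcal M^{1,\theta}(w,w^q)}$ for all $f\in\mathcal M^{1,\theta}(w,w^q)$.
   Context: The fractional integral operator (Riesz potential) on $\mathbb R^n$ is $I_\alpha f(x)=\frac1{\gamma(\alpha)}\int_{\mathbb R^n}\frac{f(y)}{|x-y|^{n-\alpha}}\,dy$, with $\gamma(\alpha)=\pi^{n/2}2^\alpha\Gamma(\alpha/2)/\Gamma((n-\alpha)/2)$. A weight is a non-negative locally integrable function $w$ on $\mathbb R^n$; $w(E)=\int_E w(x)\,dx$ for measurable $E$. In particular $w^q(E)=\int_E w(x)^q\,dx$. A weight $w$ is in $A_{1,q}$ ($1<q<\infty$) if there is $C>0$ such that for all balls $B\subset\mathbb R^n$, $\left(\frac1{|B|}\int_B w(x)^q\,dx\right)^{1/q}\left(\operatorname{ess\,sup}_{x\in B}\frac1{w(x)}\right)\le C$. For $0\le\kappa<1$, $\theta$ satisfies the $\mathcal D_\kappa$ condition if $\theta$ is a positive increasing (in the wide sense; constants such as $\theta\equiv1$ are admitted) function on $(0,+\infty)$ and there is a constant $C>0$ such that $\frac{\theta(\xi)}{\xi^\kappa}\le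 C\,\frac{\theta(\xi')}{(\xi')^\kappa}$ for all $0<\xi'<\xi<+\infty$. For $1\le p<\infty$ and weights $u,v$, $\mathcal M^{p,\theta}(v,u)$ is the space of all $f\in L^p_{loc}(v)$ with $\|f\|_{\mathcal M^{p,\theta}(v,u)}:=\sup_B\left(\frac1{\theta(u(B))}\int_B|f(x)|^pv(x)\,dx\right)^{1/p}<\infty$, and $W\mathcal M^{p,\theta}(v)$ is the space of all measurable $f$ with $\|f\|_{W\mathcal M^{p,\theta}(v)}:=\sup_B\sup_{\sigma>0}\frac1{\theta(v(B))^{1/p}}\,\sigma\cdot\left[v(\{x\in B:|f(x)|>\sigma\})\right]^{1/p}<\infty$; the suprema over $B$ are over all balls in $\mathbb R^n$. For $\gamma>0$, $\theta^{\gamma}(\xi):=[\theta(\xi)]^{\gamma}$. *)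

(* Defs.v *)
From HB Require Import structures.
From mathcomp Require Import all_boot all_order all_algebra.
From mathcomp Require Import all_classical all_reals all_analysis measurable_realfun ess_sup_inf.

Set Implicit Arguments.
Unset Strict Implicit.
Unset Printing Implicit Defensive.

Import Order.TTheory GRing.Theory Num.Theory.
Import numFieldNormedType.Exports.

Local Open Scope classical_set_scope.
Local Open Scope ring_scope.

(** R^n is ['rV[R]_n].  The library has no n-dimensional Lebesgue measure: it is
    obtained here, together with its (complete) sigma-algebra of Lebesgue
    measurable sets, by Caratheodory's construction from the outer measure
    [A |-> inf { \sum_k vol (Q_k) | A included in \bigcup_k Q_k }], where the
    infimum is over countable families of half-open boxes. *)
Section lebesgue_outer.
Context (R : realType) (n : nat).
Implicit Types (Q : 'rV[R]_n * 'rV[R]_n) (A : set 'rV[R]_n).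

Definition box Q : set 'rV[R]_n :=
  [set x | forall i, Q.1 ord0 i < x ord0 i <= Q.2 ord0 i].

Definition box_volume Q : R :=
  \prod_(i < n) Num.max 0 (Q.2 ord0 i - Q.1 ord0 i).

(* [P] selects a possibly finite, possibly empty, subfamily. *)
Definition lebesgue_outer A : \bar R :=
  ereal_inf [set s | exists (P : pred nat) (Q : nat -> 'rV[R]_n * 'rV[R]_n),
    A `<=` \bigcup_(k in [set k | P k]) box (Q k) /\
    s = (\sum_(0 <= k <oo | P k) (box_volume (Q k))%:E)%E].

Lemma box_volume_ge0 Q : 0 <= box_volume Q.
Proof. by apply: prodr_ge0 => i _; rewrite le_max lexx. Qed.

Lemma lebesgue_outer0 : lebesgue_outer set0 = 0%E.
Proof.
apply/eqP; rewrite eq_le; apply/andP; split.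
  apply: ereal_inf_lbound; exists xpred0, (fun=> (0, 0)).
  by split; [exact: sub0set | rewrite eseries0].
apply: le_ereal_inf_tmp => _ [P [Q [_ ->]]].
by apply: nneseries_ge0 => k _ _; rewrite lee_fin box_volume_ge0.
Qed.

Lemma lebesgue_outer_ge0 A : (0 <= lebesgue_outer A)%E.
Proof.
apply: le_ereal_inf_tmp => _ [P [Q [_ ->]]].
by apply: nneseries_ge0 => k _ _; rewrite lee_fin box_volume_ge0.
Qed.

Lemma le_lebesgue_outer :
  {homo lebesgue_outer : A B / A `<=` B >-> (A <= B)%E}.
Proof.
move=> A B AB; apply: le_ereal_inf_tmp => _ [P [Q [BQ ->]]].
apply: ereal_inf_lbound.
by exists P, Q; split=> //; exact: subset_trans BQ.
Qed.

Local Open Scope ereal_scope.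

Lemma lebesgue_outer_sigma_subadditive : sigma_subadditive lebesgue_outer.
Proof.
move=> A; have [[i ioo]|] := pselect (exists i, lebesgue_outer (A i) = +oo).
  rewrite (eseries_pinfty _ _ ioo) ?leey// => k _.
  by rewrite -ltNye (lt_le_trans _ (lebesgue_outer_ge0 _)).
rewrite -forallNE => Aoo.
suff add2e (e : {posnum R}) : lebesgue_outer (\bigcup_k A k) <=
    \sum_(i <oo) lebesgue_outer (A i) + e%:num%:E.
  by apply/lee_addgt0Pr => _/posnumP[].
rewrite (le_trans _ (epsilon_trick _ _ _))//; last first.
  by move=> k; exact: lebesgue_outer_ge0.
pose box' (p : bool * ('rV[R]_n * 'rV[R]_n)) := if p.1 then box p.2 else set0.
pose vol' (p : bool * ('rV[R]_n * 'rV[R]_n)) :=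
  if p.1 then (box_volume p.2)%:E else 0.
have vol'_ge0 p : 0 <= vol' p.
  by rewrite /vol'; case: ifP => // _; rewrite lee_fin box_volume_ge0.
pose P k (B : nat -> bool * ('rV[R]_n * 'rV[R]_n)) :=
  A k `<=` \bigcup_j box' (B j) /\
  \sum_(j <oo) vol' (B j) <=
    lebesgue_outer (A k) + (e%:num / (2 ^ k.+1)%:R)%:E.
have [G PG] : {G : nat -> nat -> bool * ('rV[R]_n * 'rV[R]_n) &
    forall k, P k (G k)}.
  apply: (@choice _ _ P) => k; rewrite /P.
  have en1 : (0 < e%:num / (2 ^ k.+1)%:R)%R by [].
  have fA : lebesgue_outer (A k) \is a fin_num.
    by rewrite ge0_fin_numE ?lebesgue_outer_ge0// ltey; exact/eqP/Aoo.
  have [_ [p [Q [AQ ->]] /ltW xS]] := lb_ereal_inf_adherent en1 fA.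
  exists (fun j => (p j, Q j)); split.
    by move=> t /AQ[j/= pj Qj]; exists j => //; rewrite /box' /= pj.
  by apply: le_trans xS; rewrite [in leRHS]eseries_mkcond.
have muG_ge0 x : 0 <= (vol' \o uncurry G) x by exact: vol'_ge0.
apply: (@le_trans _ _ (\esum_(i in setT) (vol' \o uncurry G) i)).
  apply: ereal_inf_lbound => /=.
  have /card_esym/ppcard_eqP[f] := card_nat2.
  exists (fun i => (uncurry G (f i)).1), (fun i => (uncurry G (f i)).2); split.
    move=> t [i _ /(PG i).1[j _]]; rewrite /box'; case: ifPn => // Gij Bijt.
    by exists (f^-1%FUN (i, j)) => /=; rewrite invK ?inE.
  rewrite [RHS]eseries_mkcond.
  rewrite -(esum_pred_image (vol' \o uncurry G) _ xpredT) ?[fun=> _]set_true//.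
  by rewrite [X in image X _]set_true image_eq.
rewrite (_ : esum _ _ = \sum_(i <oo) \sum_(j <oo ) vol' (G i j)); last first.
  pose J : nat -> set (nat * nat) := fun i => [set (i, j) | j in setT].
  rewrite (_ : setT = \bigcup_k J k); last first.
    by rewrite predeqE => -[a b]; split => // _; exists a => //; exists b.
  rewrite esum_bigcupT /=; last 2 first.
    - apply/trivIsetP => i j _ _ ij.
      rewrite predeqE => -[k m] /=; split => //= -[] [_] _ [<-{k} _].
      by move=> [m' _] [] /esym/eqP; rewrite (negbTE ij).
    - by move=> /= [k m]; exact: vol'_ge0.
  rewrite -(image_id [set: nat]) -fun_true esum_pred_image//; last first.
    by move=> k _; exact: esum_ge0.
  apply: eq_eseriesr => /= j _.
  rewrite -(esum_pred_image (vol' \o uncurry G) (pair j) predT)//=; last first.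
    by move=> ? ? _ _; exact: (@can_inj _ _ _ snd).
  by congr esum; rewrite predeqE => -[a b]; split; move=> [i _ <-]; exists i.
apply: lee_lim.
- apply: is_cvg_nneseries => k *.
  by apply: nneseries_ge0 => m *; exact: (muG_ge0 (k, m)).
- by apply: is_cvg_nneseries => k *; apply: adde_ge0 => //;
    exact: lebesgue_outer_ge0.
- by near=> k; apply: lee_sum => i _; exact: (PG i).2.
Unshelve. all: by end_near. Qed.

HB.instance Definition _ := isOuterMeasure.Build R 'rV[R]_n lebesgue_outer
  lebesgue_outer0 lebesgue_outer_ge0 le_lebesgue_outer
  lebesgue_outer_sigma_subadditive.

End lebesgue_outer.

(* Makes "measurable" on ['rV[R]_n] mean "Lebesgue measurable". *)
HB.instance Definition _ (R : realType) (n : nat) :=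
  Measurable.copy 'rV[R]_n (caratheodory_type (@lebesgue_outer R n)).

Section lebesgue.
Context (R : realType) (n : nat).

Definition lebesgue : set 'rV[R]_n -> \bar R := @lebesgue_outer R n.

HB.instance Definition _ := isMeasure.Build _ 'rV[R]_n R lebesgue
  (@caratheodory_measure0 R 'rV[R]_n (@lebesgue_outer R n))
  (@caratheodory_measure_ge0 R 'rV[R]_n (@lebesgue_outer R n))
  (@caratheodory_measure_sigma_additive R 'rV[R]_n (@lebesgue_outer R n)).

End lebesgue.

Definition enorm (R : realType) (n : nat) (x : 'rV[R]_n) : R :=
  Num.sqrt (\sum_(i < n) x ord0 i ^+ 2).

(* The library's [ball] on ['rV[R]_n] is a cube, hence this one. *)
Definition eball (R : realType) (n : nat) (x : 'rV[R]_n) (r : R) :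
  set 'rV[R]_n := [set y | enorm (y - x) < r].

Definition Gamma (R : realType) (s : R) : R :=
  \int[@lebesgue_measure R]_(t in `]0, +oo[) (t `^ (s - 1) * expR (- t)).

(* Powers [w^q] of a weight and [theta^q] of a growth function. *)
Definition fpow (R : realType) (T : Type) (h : T -> R) (q : R) : T -> R :=
  fun x => h x `^ q.

Section weighted_morrey.
Context (R : realType) (n : nat).
Implicit Types (alpha p q kappa : R) (theta : R -> R).
Implicit Types (u v w f : 'rV[R]_n -> R) (g : 'rV[R]_n -> \bar R).

Definition riesz_gamma alpha : R :=
  pi `^ (n%:R / 2) * 2 `^ alpha * Gamma (alpha / 2) / Gamma ((n%:R - alpha) / 2).

(* Extended-real valued: at a point where the positive and the negative parts
   of the integrand both have an infinite integral, the value is [-oo] and so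
   counts as a point where [`|riesz_potential alpha f|] is infinite. *)
Definition riesz_potential alpha f (x : 'rV[R]_n) : \bar R :=
  ((riesz_gamma alpha)^-1%:E *
   \int[@lebesgue R n]_y (f y / enorm (x - y) `^ (n%:R - alpha))%:E)%E.

Definition loc_integrable f : Prop :=
  measurable_fun setT f /\
  forall K : set 'rV[R]_n, compact K ->
    (\int[@lebesgue R n]_(x in K) `|f x|%:E < +oo)%E.

Definition is_weight w : Prop := (forall x, 0 <= w x) /\ loc_integrable w.

Definition weight_meas w (E : set 'rV[R]_n) : \bar R :=
  (\int[@lebesgue R n]_(x in E) (w x)%:E)%E.

(* The inverse of [w x] is taken in [\bar R], so it is [+oo] where [w]
   vanishes; as it is nonnegative, its essential supremum over [B] is that of
   its extension by 0. *)
Definition A1 q w : Prop :=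
  is_weight w /\
  exists2 C : R, 0 < C & forall (x0 : 'rV[R]_n) (r : R), 0 < r ->
    let B := eball x0 r in
    (((lebesgue B)^-1 * weight_meas (fpow w q) B) `^ q^-1 *
     ess_sup (@lebesgue R n) ((fun x => ((w x)%:E)^-1) \_ B) <= C%:E)%E.

Definition D_condition kappa theta : Prop :=
  [/\ 0 <= kappa < 1,
      forall xi, 0 < xi -> 0 < theta xi,
      forall xi' xi, 0 < xi' -> xi' <= xi -> theta xi' <= theta xi &
      exists2 C : R, 0 < C & forall xi' xi, 0 < xi' -> xi' < xi ->
        theta xi / xi `^ kappa <= C * (theta xi' / xi' `^ kappa)].

Definition morrey_norm p theta v u f : \bar R :=
  ereal_sup [set s | exists (x0 : 'rV[R]_n) (r : R), 0 < r /\
    let B := eball x0 r in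
    s = (((theta (fine (weight_meas u B)))^-1%:E *
          \int[@lebesgue R n]_(x in B) (`|f x| `^ p * v x)%:E) `^ p^-1)%E].

Definition morrey p theta v u f : Prop :=
  [/\ measurable_fun setT f,
      loc_integrable (fun x => `|f x| `^ p * v x) &
      (morrey_norm p theta v u f < +oo)%E].

Definition weak_morrey_norm p theta v g : \bar R :=
  ereal_sup [set s | exists (x0 : 'rV[R]_n) (r sigma : R),
    [/\ 0 < r, 0 < sigma &
     let B := eball x0 r in
     s = (((theta (fine (weight_meas v B)) `^ p^-1)^-1 * sigma)%:E *
          weight_meas v (B `&` [set x | (sigma%:E < `|g x|)%E]) `^ p^-1)%E]].

Definition weak_morrey p theta v g : Prop :=
  measurable_fun setT g /\ (weak_morrey_norm p theta v g < +oo)%E.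

End weighted_morrey.

(* Main.v *)
Require Import Defs.
From HB Require Import structures.
From mathcomp Require Import all_boot all_order all_algebra.
From mathcomp Require Import all_classical all_reals all_analysis measurable_realfun ess_sup_inf.
From mathcomp Require Import ring lra.
Import Order.TTheory GRing.Theory Num.Theory.
Import numFieldNormedType.Exports.
Local Open Scope classical_set_scope.
Local Open Scope ring_scope.

Set Implicit Arguments.
Unset Strict Implicit.
Unset Printing Implicit Defensive.

(** Write [v = w^q], [V E] for the integral of [v] over [E], [beta = n - alpha]
    and [s = 1/q = 1 - alpha/n = beta/n].  The proof uses neither a maximal
    function nor a covering lemma: the weak-type bound is obtained by testing
    the potential against [v] on a level set.

    Let [B] be a ball of radius [r], [E] the part of [B] where [|I_alpha f|]
    exceeds [sigma], and [k_E y] the integral of [v x / |x - y|^beta] over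
    [x] in [E].  By Tonelli ([riesz_weak_duality]), up to the normalising
    constant of [I_alpha],
      [sigma * V E <= \int_E |I_alpha f| v <= \int |f y| * k_E y dy],
    so everything rests on an upper bound for [k_E].

    Raised to the power [q], the condition on [w] says that [v] is an [A_1]
    weight: [V (B x r) <= A * r^n * v y] for almost every [y] in the ball
    ([A1_muckenhoupt]).  Three consequences are used.
    - For almost every [y] this holds at once for all balls centred at [y]
      ([muckenhoupt_centered]).  Splitting [k_E y] at the radius [t] with
      [t^n = V E / v y] and summing over dyadic annuli inside that radius gives
      [k_E y <= C * (V E)^(alpha/n) * (v y)^s] ([kernel_estimate]); note that
      [(v y)^s = w y].
    - [V] is doubling ([doubling]), hence reverse doubling: some [rho < 1] has
      [V B <= rho * V (4 B)] for all balls ([reverse_doubling]).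
    - If [y] lies in [B_j = 4^(j+1) B] but not in [B_(j-1)], the kernel is at
      most a constant times [(4^(j+1) r)^(-beta)] on [E], and the [A_1]
      condition on [B_j] turns this into
      [k_E y <= C * (V E)^(alpha/n) * (V B / V B_j)^s * w y]
      ([kernel_shells]).

    Up to the factor [C * (V E)^(alpha/n)], the [j]-th shell then contributes at
    most [(V B / V B_j)^s * theta (V B_j)] times the Morrey norm [|f|] of [f].
    By the condition on [theta] the first product is at most a constant times
    [theta (V B) * (V B / V B_j)^(s - kappa)], which decays geometrically in [j]
    by reverse doubling, as [kappa < s] ([D_condition_decay]).  Thus
      [sigma * V E <= C * (V E)^(alpha/n) * theta (V B) * |f|],
    and dividing by [(V E)^(alpha/n)] is the assertion. *)

(** * Lebesgue measurability of coordinates, distances and balls *)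

Section lebesgue_measurability.
Context (R : realType) (n : nat).
Implicit Types (x y : 'rV[R]_n) (r a : R).

(** Either half may be an empty box; the truncation at 0 in the volume makes
    the identity hold in that case too. *)
Lemma box_volume_cut (Q : 'rV[R]_n * 'rV[R]_n) (i : 'I_n) a :
  box_volume (Q.1, \row_j if j == i then Num.min (Q.2 ord0 j) a else Q.2 ord0 j) +
  box_volume (\row_j if j == i then Num.max (Q.1 ord0 j) a else Q.1 ord0 j, Q.2)
  = box_volume Q.
Proof.
pose L := \prod_(j < n | j != i) Num.max 0 (Q.2 ord0 j - Q.1 ord0 j).
have split_i (A B : 'rV[R]_n) : (forall j, j != i -> A ord0 j = Q.1 ord0 j) ->
    (forall j, j != i -> B ord0 j = Q.2 ord0 j) ->
    box_volume (A, B) = Num.max 0 (B ord0 i - A ord0 i) * L.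
  move=> AQ BQ; rewrite /box_volume /= (bigD1 i) //=; congr (_ * _).
  by apply: eq_bigr => j ji; rewrite AQ ?BQ.
rewrite (split_i Q.1) // ?split_i //; last 2 first.
- by move=> j /negbTE ji; rewrite mxE ji.
- by move=> j /negbTE ji; rewrite mxE ji.
have -> : box_volume Q = Num.max 0 (Q.2 ord0 i - Q.1 ord0 i) * L.
  by rewrite /box_volume (bigD1 i).
rewrite !mxE eqxx -mulrDl; congr (_ * _).
move: (Q.1 ord0 i) (Q.2 ord0 i) => l b.
by rewrite /Num.max /Num.min; do !case: ifPn; rewrite -?leNgt; lra.
Qed.

(** Each box of a cover of [X] is cut by the hyperplane into two boxes of the
    same total volume, and the two families cover the two parts of [X]. *)
Lemma caratheodory_halfspace (i : 'I_n) a :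
  measurable [set x : 'rV[R]_n | a < x ord0 i].
Proof.
rewrite -[X in measurable X]setCK; apply: measurableC.
have -> : ~` [set x : 'rV[R]_n | a < x ord0 i] = [set x | x ord0 i <= a].
  by apply/seteqP; split=> x /=; rewrite leNgt => /negP.
apply: (@le_caratheodory_measurable R 'rV[R]_n (@lebesgue_outer R n)) => X.
apply: le_ereal_inf_tmp => _ [P [Q [XQ ->]]].
pose Q1 k := ((Q k).1,
  \row_j if j == i then Num.min ((Q k).2 ord0 j) a else (Q k).2 ord0 j).
pose Q2 k := (\row_j if j == i then Num.max ((Q k).1 ord0 j) a
  else (Q k).1 ord0 j, (Q k).2).
rewrite (eq_eseriesr (g := fun k =>
  (box_volume (Q1 k))%:E + (box_volume (Q2 k))%:E)%E); last first.
  by move=> k _; rewrite -EFinD box_volume_cut.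
rewrite nneseriesD => [|k _ _|k _ _]; rewrite ?lee_fin ?box_volume_ge0 //.
apply: leeD; apply: ereal_inf_lbound; exists P; eexists; split; [|reflexivity| |reflexivity].
- move=> x [/XQ[k /= Pk Qx] xa]; exists k => //= j /=; rewrite mxE.
  by have := Qx j; case: eqP => // ->; rewrite le_min xa andbT.
- move=> x [/XQ[k /= Pk Qx] /negP]; rewrite -ltNge => xa; exists k => //= j /=.
  by rewrite mxE; have := Qx j; case: eqP => // ->; rewrite gt_max xa andbT.
Qed.

Lemma measurable_coord (i : 'I_n) :
  measurable_fun setT (fun x : 'rV[R]_n => x ord0 i).
Proof.
apply: (measurability _ (RGenOInfty.measurableE R)) => _ [_ [a ->] <-].
rewrite setTI; have -> : (fun x : 'rV[R]_n => x ord0 i) @^-1` `]a, +oo[ =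
    [set x | a < x ord0 i] by apply/seteqP; split=> x /=; rewrite in_itv /= andbT.
exact: caratheodory_halfspace.
Qed.

(** Stated for two maps so that it serves both for balls and, on the product
    space, for the kernel of the potential. *)
Lemma measurable_enormB d (T : measurableType d) (f g : T -> 'rV[R]_n) :
  measurable_fun setT f -> measurable_fun setT g ->
  measurable_fun setT (fun t => enorm (f t - g t)).
Proof.
move=> mf mg.
have -> : (fun t => enorm (f t - g t)) =
    (fun t => (\sum_(i < n) (f t ord0 i - g t ord0 i) ^+ 2) `^ 2^-1).
  apply/funext => t; rewrite powR12_sqrt; last by apply: sumr_ge0 => i _; exact: sqr_ge0.
  by congr Num.sqrt; apply: eq_bigr => i _; rewrite !mxE.
apply: (measurableT_comp (measurable_powR _ : measurable_fun setT _)).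
apply: measurable_sum => i; apply: measurable_funX; apply: measurable_funB.
  exact: (measurableT_comp (measurable_coord i)).
exact: (measurableT_comp (measurable_coord i)).
Qed.

Lemma measurable_eball x r : measurable (eball x r).
Proof.
have := @measurable_fun_ltr _ 'rV[R]_n R setT (fun y => enorm (y - x)) (cst r)
  (measurable_enormB (@measurable_id _ _ _) (@measurable_cst _ _ _ _ _ x))
  (@measurable_cst _ _ _ _ _ r) measurableT [set true].
rewrite setTI.
have -> : (fun t : 'rV[R]_n => enorm (t - x) < cst r t) @^-1` [set true] = eball x r.
  by apply/seteqP; split => y /=.
exact.
Qed.

End lebesgue_measurability.

(** * Euclidean balls and their volume *)

Section euclidean_balls.
Context (R : realType) (n : nat).
Implicit Types (x y z : 'rV[R]_n) (r : R).

Lemma enorm_ge0 x : 0 <= enorm x.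
Proof. exact: sqrtr_ge0. Qed.

Lemma enorm_sqr x : enorm x ^+ 2 = \sum_(i < n) x ord0 i ^+ 2.
Proof. by rewrite sqr_sqrtr //; apply: sumr_ge0 => i _; exact: sqr_ge0. Qed.

Lemma enormN x : enorm (- x) = enorm x.
Proof. by congr Num.sqrt; apply: eq_bigr => i _; rewrite mxE sqrrN. Qed.

Lemma enormZ r x : 0 <= r -> enorm (r *: x) = r * enorm x.
Proof.
move=> r0; rewrite -[in RHS](ger0_norm r0) -sqrtr_sqr -sqrtrM ?sqr_ge0 //.
by congr Num.sqrt; rewrite mulr_sumr; apply: eq_bigr => i _; rewrite mxE exprMn.
Qed.

Lemma normr_coord_le x i : `|x ord0 i| <= enorm x.
Proof.
rewrite -sqrtr_sqr ler_sqrt; last by apply: sumr_ge0 => j _; exact: sqr_ge0.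
by rewrite (bigD1 i) //= lerDl; apply: sumr_ge0 => j _; exact: sqr_ge0.
Qed.

Lemma enorm_eq0 x : enorm x = 0 -> x = 0.
Proof.
move=> x0; apply/rowP => i; rewrite mxE; apply/eqP; rewrite -normr_le0 -x0.
exact: normr_coord_le.
Qed.

Lemma enormD x y : enorm (x + y) <= enorm x + enorm y.
Proof.
have [/eqP/enorm_eq0 ->|x0] := boolP (enorm x == 0).
  by rewrite add0r lerDr enorm_ge0.
have [/eqP/enorm_eq0 ->|y0] := boolP (enorm y == 0).
  by rewrite addr0 lerDl enorm_ge0.
have a0 : 0 < enorm x by rewrite lt_neqAle eq_sym x0 enorm_ge0.
have b0 : 0 < enorm y by rewrite lt_neqAle eq_sym y0 enorm_ge0.
rewrite -(@ler_pXn2r _ 2) ?nnegrE ?addr_ge0 ?enorm_ge0 // enorm_sqr.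
set a := enorm x in a0 *; set b := enorm y in b0 *.
(* In each coordinate, with weights that make the sum equal to (a + b)^2. *)
apply: (@le_trans _ _ (\sum_(i < n) ((1 + b / a) * x ord0 i ^+ 2 +
                                     (1 + a / b) * y ord0 i ^+ 2))).
  apply: ler_sum => i _; rewrite mxE -subr_ge0.
  move: (x ord0 i) (y ord0 i) => s t.
  have -> : (1 + b / a) * s ^+ 2 + (1 + a / b) * t ^+ 2 - (s + t) ^+ 2 =
     (b * s - a * t) ^+ 2 / (a * b) by field; rewrite !gt_eqF.
  by rewrite divr_ge0 ?sqr_ge0 // mulr_ge0 // ltW.
rewrite big_split /= -!mulr_sumr -!enorm_sqr -/a -/b.
by rewrite le_eqVlt; apply/orP; left; apply/eqP; field; rewrite !gt_eqF.
Qed.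

Lemma enormB x y : enorm (x - y) = enorm (y - x).
Proof. by rewrite -enormN opprB. Qed.

Lemma subset_eball x y r r' : enorm (y - x) + r' <= r -> eball y r' `<=` eball x r.
Proof.
move=> yx z; rewrite /eball /= => zy.
have -> : z - x = (z - y) + (y - x) by rewrite addrA subrK.
by apply: (le_lt_trans (enormD _ _)); lra.
Qed.

Lemma le_eball x r r' : r <= r' -> eball x r `<=` eball x r'.
Proof. by move=> rr' z /= zx; exact: lt_le_trans rr'. Qed.

(** A homothety carries covers by boxes to covers by boxes.  The inequality
    for the inverse homothety yields equality. *)
Lemma lebesgue_outer_homothety_le (A : set 'rV[R]_n) x r : 0 < r ->
  (lebesgue_outer [set y | A (r^-1 *: (y - x))%R] <= (r ^+ n)%:E * lebesgue_outer A)%E.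
Proof.
move=> r0; rewrite -lee_pdivrMl ?exprn_gt0 //; apply: le_ereal_inf_tmp => _ [P [Q [AQ ->]]].
rewrite lee_pdivrMl ?exprn_gt0 // -nneseriesZl; last first.
  by move=> k _; rewrite lee_fin box_volume_ge0.
apply: ereal_inf_lbound; exists P, (fun k => (r *: (Q k).1 + x, r *: (Q k).2 + x)).
split.
  move=> y /AQ[k /= Pk Qy]; exists k => //= i; have := Qy i.
  by rewrite !mxE -ltrBrDr -lerBlDr -ltr_pdivlMl // -ler_pdivrMl.
apply: eq_eseriesr => k _; rewrite -EFinM; congr EFin.
rewrite /box_volume /= -[X in r ^+ X](card_ord n) -prodr_const -big_split /=.
apply: eq_bigr => i _; rewrite !mxE /= opprD addrACA subrr addr0 -mulrBr.
by rewrite maxr_pMr ?mulr0 // ltW.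
Qed.

(** Reduces the volume of a ball to that of the unit ball, whose finiteness
    comes from covering it by a cube and whose positivity is deduced later from
    the existence of a weight of nonzero mass ([unit_ball_gt0]). *)
Lemma lebesgue_eball x r : 0 < r ->
  lebesgue (eball x r) = ((r ^+ n)%:E * lebesgue (eball (0 : 'rV[R]_n) 1%R))%E.
Proof.
move=> r0; apply/eqP; rewrite eq_le; apply/andP; split.
  apply: le_trans (lebesgue_outer_homothety_le _ x r0).
  apply: le_lebesgue_outer => y; rewrite /eball /=.
  by rewrite subr0 enormZ ?invr_ge0 ?ltW // mulrC ltr_pdivrMr ?mul1r.
rewrite -lee_pdivlMl ?exprn_gt0 // -exprVn.
apply: le_trans (@lebesgue_outer_homothety_le _ (- (r^-1 *: x)) (r^-1) _); last first.
  by rewrite invr_gt0.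
apply: le_lebesgue_outer => y; rewrite /eball /=.
rewrite subr0 opprK invrK scalerDr scalerA divff ?gt_eqF // scale1r addrK.
by rewrite enormZ ?ltW // => ?; rewrite gtr_pMr.
Qed.

Lemma lebesgue_unit_ball_fin : (lebesgue (eball (0 : 'rV[R]_n) 1) < +oo)%E.
Proof.
apply: (@le_lt_trans _ _ (box_volume (const_mx (- 1) : 'rV[R]_n, const_mx 1))%:E);
  last by rewrite ltry.
apply: ereal_inf_lbound; exists (pred1 0%N), (fun=> (const_mx (- 1), const_mx 1)).
split.
  move=> y; rewrite /eball /= subr0 => y1; exists 0%N => //= i; rewrite !mxE.
  have := normr_coord_le y i; rewrite ler_norml => /andP[? ?]; apply/andP; split; lra.
rewrite (nneseriesD1 (n := 0%N)) //; last first.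
  by move=> k _; rewrite lee_fin box_volume_ge0.
by rewrite eseries0 ?adde0 // => k _ /andP[/eqP ->].
Qed.

Lemma exists_nat_eball y : exists k : nat, eball (0 : 'rV[R]_n) k.+1%:R y.
Proof. by exists (Num.trunc (enorm y)); rewrite /eball /= subr0 truncnS_gt. Qed.

Lemma lebesgue_sigma_finite : sigma_finite setT (@lebesgue R n).
Proof.
exists (fun k => eball (0 : 'rV[R]_n) k.+1%:R).
  apply/seteqP; split=> // y _; have [k yk] := exists_nat_eball y.
  by exists k.
move=> k; split; first exact: measurable_eball.
by rewrite lebesgue_eball // lte_mul_pinfty ?lee_fin ?exprn_ge0 // lebesgue_unit_ball_fin.
Qed.

HB.instance Definition _ := Measure_isSigmaFinite.Build _ _ R (@lebesgue R n)
  lebesgue_sigma_finite.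

End euclidean_balls.

(** * The A_1 condition *)

Section muckenhoupt.
Context (R : realType) (n : nat).
Implicit Types (x y z : 'rV[R]_n) (r A : R) (v : 'rV[R]_n -> R).
Local Notation mu := (@lebesgue R n).

(** The classical [A_1] condition bounds the average of [v] over the ball by
    its essential infimum there; the almost-everywhere form is the one that
    can be integrated, and [r ^+ n] stands for the volume of the ball. *)
Definition muckenhoupt_A1 A v : Prop := forall x r, 0 < r ->
  \forall y \ae mu, eball x r y ->
    (weight_meas v (eball x r) <= (A * r ^+ n * v y)%:E)%E.

Lemma weight_meas_ge0 v (E : set 'rV[R]_n) : (forall y, 0 <= v y) ->
  (0 <= weight_meas v E)%E.
Proof. by move=> v0; apply: integral_ge0 => y _; rewrite lee_fin. Qed.

Lemma weight_meas_null v (E : set 'rV[R]_n) : measurable_fun setT v ->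
  measurable E -> mu E = 0%E -> weight_meas v E = 0%E.
Proof.
move=> mv mE E0; apply: null_set_integral => //.
by apply/measurable_EFinP; exact: measurable_funS mv.
Qed.

Lemma le_weight_meas v (E F : set 'rV[R]_n) : measurable_fun setT v ->
  (forall y, 0 <= v y) -> measurable E -> measurable F -> E `<=` F ->
  (weight_meas v E <= weight_meas v F)%E.
Proof.
move=> mv v0 mE mF EF; apply: ge0_subset_integral => //.
- by apply/measurable_EFinP; exact: measurable_funS mv.
- by move=> y _; rewrite lee_fin.
Qed.

Lemma measurable_fpow v p : measurable_fun setT v -> measurable_fun setT (fpow v p).
Proof. exact: (measurableT_comp (measurable_powR p)). Qed.

(** Almost everywhere on the ball [1 / w] is at most its essential supremum,
    so that [A1] gives [(V B / |B|)^(1/q) <= C * w y]; take [q]-th powers. *)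
Lemma A1_muckenhoupt q (w : 'rV[R]_n -> R) : 0 < q -> A1 q w ->
  exists2 A, 0 < A & muckenhoupt_A1 A (fpow w q).
Proof.
move=> q0 [[w0 [mw _]] [C C0 wC]].
have fin1 := lebesgue_unit_ball_fin R n.
pose c := fine (mu (eball 0 1)).
have c0 : 0 <= c by apply: fine_ge0; exact: measure_ge0.
have cE : mu (eball 0 1) = c%:E by rewrite fineK // ge0_fin_numE ?measure_ge0.
exists (C `^ q * (c + 1)); first by rewrite mulr_gt0 ?powR_gt0 // ltr_wpDl.
move=> x r r0; have := wC x r r0; rewrite /= lebesgue_eball // cE -EFinM.
set V := weight_meas _ _; set S := ess_sup _ _ => wS.
have v0 y : 0 <= fpow w q y by exact: powR_ge0.
have V0 : (0 <= V)%E by exact: weight_meas_ge0.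
have := ess_sup_ge mu ((fun y => ((w y)%:E)^-1)%E \_ (eball x r)).
apply: filterS => y /= Sy By; move: Sy; rewrite patchE mem_set //.
rewrite -/S => Sy.
(* A nonzero mass makes the average positive, which rules out w y = 0. *)
have [V00|Vn0] := eqVneq V 0%E.
  by rewrite V00 lee_fin !mulr_ge0 ?exprn_ge0 ?powR_ge0 ?addr_ge0 // ltW.
have Vp : (0 < V)%E by rewrite lt_neqAle eq_sym Vn0.
have b0 : 0 < r ^+ n * c.
  rewrite lt_neqAle; apply/andP; split; last by rewrite mulr_ge0 // exprn_ge0 // ltW.
  rewrite eq_sym; apply: contra Vn0 => /eqP b0; apply/eqP; apply: weight_meas_null.
  - exact: measurable_fpow.
  - exact: measurable_eball.
  - by rewrite lebesgue_eball // cE -EFinM b0.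
have avg0 : (0 < ((r ^+ n * c)%:E^-1 * V) `^ q^-1)%E.
  by rewrite poweR_gt0 // mule_gt0 // inver gt_eqF // lte_fin invr_gt0.
move: Sy; rewrite inver; case: eqP => [_|/eqP wn0].
  rewrite leye_eq => /eqP Sy; move: wS.
  by rewrite Sy gt0_muley // leye_eq.
have wp : 0 < w y by rewrite lt_neqAle eq_sym wn0 w0.
move=> Sy; have : (((r ^+ n * c)%:E^-1 * V) `^ q^-1 * (w y)^-1%:E <= C%:E)%E.
  by apply: le_trans wS; rewrite lee_wpmul2l // ltW.
rewrite lee_pdivrMr // -EFinM => /(gt0_ler_poweR (ltW q0)).
rewrite !in_itv /= !leey !andbT poweR_ge0 lee_fin mulr_ge0 ?(ltW C0) ?(ltW wp) //.
rewrite -poweRrM mulVf ?gt_eqF // poweRe1 => [/(_ isT isT)|]; last first.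
  by rewrite mule_ge0 // inve_ge0 lee_fin ltW.
rewrite inver gt_eqF // lee_pdivrMl // -EFinM => VC.
apply: (le_trans VC); rewrite lee_fin powRM ?(ltW C0) // /fpow mulrA.
apply: ler_wpM2r; first exact: powR_ge0.
have := powR_ge0 C q; have : 0 <= r ^+ n by rewrite exprn_ge0 // ltW.
by move: (r ^+ n) (C `^ q) c0 => s D; nra.
Qed.

End muckenhoupt.

(** * Balls under an A_1 weight: centred form, doubling, reverse doubling *)

Section A1_weights.
Context (R : realType) (n : nat) (A : R) (v : 'rV[R]_n -> R).
Context (A0 : 0 < A) (mv : measurable_fun setT v) (v0 : forall y, 0 <= v y).
Context (vA : muckenhoupt_A1 A v).
Implicit Types (x y z : 'rV[R]_n) (r : R).
Local Notation mu := (@lebesgue R n).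

(** An infinite mass would force [v = +oo] almost everywhere on the ball,
    hence a null ball, whose mass is 0. *)
Lemma muckenhoupt_fin x r : 0 < r -> (weight_meas v (eball x r) < +oo)%E.
Proof.
move=> r0; rewrite ltey; apply/eqP => Vy.
have B0 : mu (eball x r) = 0%E.
  apply: measure_negligible; first exact: measurable_eball.
  have := vA x r0; rewrite Vy; apply: negligibleS => y By /= /(_ By).
  by rewrite leye_eq.
by move: Vy; rewrite weight_meas_null //; exact: measurable_eball.
Qed.

Definition wball x r : R := fine (weight_meas v (eball x r)).

Lemma wballE x r : 0 < r -> weight_meas v (eball x r) = (wball x r)%:E.
Proof.
by move=> r0; rewrite /wball fineK // ge0_fin_numE ?weight_meas_ge0 // muckenhoupt_fin.
Qed.

Lemma wball_ge0 x r : 0 <= wball x r.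
Proof. by apply: fine_ge0; exact: weight_meas_ge0. Qed.

Lemma le_wball x r y r' : 0 < r -> 0 < r' -> eball x r `<=` eball y r' ->
  wball x r <= wball y r'.
Proof.
move=> r0 r'0 sub; rewrite -lee_fin -!wballE //.
by apply: le_weight_meas => //; exact: measurable_eball.
Qed.

Lemma weight_meas_sub_fin (E : set 'rV[R]_n) x r : 0 < r -> measurable E ->
  E `<=` eball x r -> (weight_meas v E <= (wball x r)%:E)%E.
Proof.
move=> r0 mE EB; rewrite -wballE //.
by apply: le_weight_meas => //; exact: measurable_eball.
Qed.

Lemma exists_grid_point (d : R) y : 0 < d -> exists m : 'rV[int]_n,
  enorm (y - d *: map_mx intr m) <= n%:R * d.
Proof.
move=> d0; exists (\row_i Num.floor (y ord0 i / d)).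
have d0' := ltW d0.
rewrite -[leRHS]ger0_norm ?mulr_ge0 // -sqrtr_sqr ler_sqrt ?sqr_ge0 //.
apply: (@le_trans _ _ (\sum_(i < n) d ^+ 2)).
  apply: ler_sum => i _; rewrite !mxE.
  have /andP[] := floor_itv (y ord0 i / d).
  move: (Num.floor _) => f; rewrite intrD ler_pdivlMr // ltr_pdivrMr // => ? ?.
  by rewrite ler_pXn2r ?nnegrE //; lra.
rewrite sumr_const card_ord exprMn -[leLHS]mulr_natl ler_wpM2r ?sqr_ge0 //.
by rewrite -natrX ler_nat; case: (n) => // k; rewrite -[leqLHS]expn1 leq_pexp2l.
Qed.

(** The exceptional null set in [muckenhoupt_A1] depends on the ball, and [y]
    is the centre of uncountably many balls.  Each of them is contained in a
    ball of comparable radius taken from a countable family: centres on the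
    grids [d * Z^n] and radii in [d * N], where [d] ranges over the [1 / j]. *)
Lemma muckenhoupt_centered : \forall y \ae mu, forall r, 0 < r ->
  wball y r <= A * (n%:R + 2) ^+ n * r ^+ n * v y.
Proof.
pose good (N : nat) y := if unpickle N is Some (j, k, m) then
  eball ((j.+1%:R : R)^-1 *: map_mx intr (m : 'rV[int]_n)) (k.+1%:R / j.+1%:R) y ->
  wball (j.+1%:R^-1 *: map_mx intr m) (k.+1%:R / j.+1%:R) <=
    A * (k.+1%:R / j.+1%:R) ^+ n * v y else True.
have : \forall y \ae mu, forall N, good N y.
  apply: ae_foralln => N; rewrite /good.
  case: unpickle => [[[j k] m]|]; last exact: aeW.
  have r0 : 0 < k.+1%:R / j.+1%:R :> R by rewrite divr_gt0.
  apply: filterS (vA _ r0) => y /[apply]; by rewrite wballE // lee_fin.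
apply: filterS => y goody r r0.
(* The mesh d is at most r and the grid point is within n d of y; the radius
   (k + 1) d exceeds r + n d by at most d, so it is at most (n + 2) r. *)
pose j := Num.trunc r^-1; pose d : R := j.+1%:R^-1.
have d0 : 0 < d by rewrite invr_gt0.
have dr : d <= r by rewrite -[leRHS]invrK lef_pV2 ?posrE ?invr_gt0 // ltW // truncnS_gt.
have [m ym] := exists_grid_point y d0.
pose k := Num.trunc ((r + n%:R * d) / d).
have rd0 : 0 <= (r + n%:R * d) / d.
  by rewrite divr_ge0 ?addr_ge0 ?mulr_ge0 // ltW.
have /andP[k1 k2] := truncn_itv rd0.
rewrite ler_pdivlMr // in k1; rewrite ltr_pdivrMr // in k2.
have n0 : 0 <= n%:R :> R by [].
have yB : eball (d *: map_mx intr m) (k.+1%:R * d) y.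
  by rewrite /eball /=; apply: (le_lt_trans ym); lra.
have := goody (pickle (j, k, m)); rewrite /good pickleK => /(_ yB) W.
apply: (@le_trans _ _ (A * (k.+1%:R * d) ^+ n * v y)).
  apply: le_trans W; apply: le_wball => //.
  by apply: subset_eball; rewrite -/d; lra.
apply: ler_wpM2r => //; rewrite -mulrA; apply: ler_wpM2l; first exact: ltW.
rewrite -exprMn.
apply: lerXn2r; rewrite ?nnegrE ?mulr_ge0 ?addr_ge0 ?(ltW d0) ?(ltW r0) //.
rewrite -natr1 mulrDl mul1r mulrDl; apply: (@le_trans _ _ (r + n%:R * d + d)); first lra.
have : n%:R * d <= n%:R * r by rewrite ler_wpM2l.
lra.
Qed.

Let c := fine (mu (eball 0 1)).

(** The [A_1] condition on the large ball, integrated over the small one. *)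
Lemma doubling x r y r' : 0 < r -> 0 < r' -> eball y r' `<=` eball x r ->
  c * r' ^+ n * wball x r <= A * r ^+ n * wball y r'.
Proof.
move=> r0 r'0 sub.
have cE : mu (eball 0 1) = c%:E.
  by rewrite fineK // ge0_fin_numE ?measure_ge0 // lebesgue_unit_ball_fin.
have k0 : 0 <= A * r ^+ n by rewrite mulr_ge0 ?exprn_ge0 // ltW.
have mB := measurable_eball y r'.
have mvE : measurable_fun (eball y r') (EFin \o v).
  by apply/measurable_EFinP; exact: measurable_funS mv.
have cst_int : (\int[mu]_(z in eball y r') (cst (wball x r)%:E z) =
    (c * r' ^+ n * wball x r)%:E)%E.
  rewrite integral_cst //; transitivity ((wball x r)%:E * mu (eball y r'))%E => //.
  by rewrite lebesgue_eball // cE -!EFinM mulrC (mulrC c).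
rewrite -lee_fin -cst_int EFinM -(wballE y r'0) /weight_meas.
rewrite -ge0_integralZl_EFin //; last first.
  by move=> z _; rewrite lee_fin.
apply: ae_ge0_le_integral => //.
- by move=> z _; rewrite lee_fin wball_ge0.
- by move=> z _; rewrite -EFinM lee_fin mulr_ge0.
- exact: measurable_funeM.
- apply: filterS (vA x r0) => z /(_ (sub _ _)) xz Bz.
  by rewrite -EFinM -wballE //; exact: xz.
Qed.

Lemma weight_meas_exhaust0 x r : 0 < r ->
  (forall k : nat, wball x (r + k%:R) = 0) -> weight_meas v setT = 0%E.
Proof.
move=> r0 Wk.
have mvE : measurable_fun setT (EFin \o v) by apply/measurable_EFinP.
have v_abs (E : set 'rV[R]_n) : (\int[mu]_(z in E) `|(EFin \o v) z| = weight_meas v E)%E.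
  by apply: eq_integral => z _; rewrite /= ger0_norm.
rewrite -v_abs; apply/ae_eq_integral_abs => //.
have : \forall z \ae mu, forall k : nat, eball x (r + k%:R) z -> (v z)%:E = 0%E.
  apply: ae_foralln => k; apply/ae_eq_integral_abs.
  - exact: measurable_eball.
  - exact: measurable_funS mvE.
  - by rewrite v_abs wballE ?Wk // ltr_wpDr.
apply: filterS => z vz _; apply: (vz (Num.trunc (enorm (z - x))).+1).
rewrite /eball /=; apply: (lt_le_trans (truncnS_gt _)); rewrite lerDr; exact: ltW.
Qed.

Context (nontrivial : weight_meas v setT != 0%E).

(** If the unit ball were null, so would be all balls, and [v] would have
    total mass 0. *)
Lemma unit_ball_gt0 : 0 < c.
Proof.
rewrite lt_neqAle eq_sym fine_ge0 ?measure_ge0 // andbT.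
apply: contra nontrivial => /eqP c0; apply/eqP.
apply: (@weight_meas_exhaust0 0 1) => // k; rewrite /wball weight_meas_null //.
  exact: measurable_eball.
rewrite lebesgue_eball ?ltr_wpDr //.
rewrite -[X in (_ * X)%E]fineK ?ge0_fin_numE ?measure_ge0 ?lebesgue_unit_ball_fin //.
by rewrite -/c c0 mule0.
Qed.

Lemma wball_gt0 x r : 0 < r -> 0 < wball x r.
Proof.
move=> r0; rewrite lt_neqAle eq_sym wball_ge0 andbT.
apply: contra nontrivial => /eqP W0; apply/eqP.
apply: (@weight_meas_exhaust0 x r) => // k.
have rk : 0 < r + k%:R by rewrite ltr_wpDr.
have rrk : r <= r + k%:R by rewrite lerDl.
have := doubling rk r0 (le_eball (x := x) rrk).
rewrite W0 mulr0 pmulr_rle0; last by rewrite mulr_gt0 ?exprn_gt0 // unit_ball_gt0.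
by move=> ?; apply/eqP; rewrite eq_le wball_ge0 andbT.
Qed.

Lemma doubling4 x r : 0 < r -> wball x (4 * r) <= A * 4 ^+ n / c * wball x r.
Proof.
move=> r0; have r4 : 0 < 4 * r by rewrite mulr_gt0.
have : eball x r `<=` eball x (4 * r) by apply: le_eball; lra.
move=> /(doubling r4 r0); have c0 := unit_ball_gt0; have rn : 0 < r ^+ n by rewrite exprn_gt0.
rewrite exprMn => W; rewrite mulrAC ler_pdivlMr // -(ler_pM2r rn); lra.
Qed.

(** The ball of radius [4 r] contains, besides the concentric ball of radius
    [r], a disjoint translate of it, which by doubling carries a fixed
    fraction of the mass. *)
Lemma reverse_doubling : (0 < n)%N -> exists2 rho : R, 0 < rho < 1 &
  forall x r, 0 < r -> wball x r <= rho * wball x (4 * r).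
Proof.
move=> n0; have c0 := unit_ball_gt0.
have d0 : 0 < c / (A * 4 ^+ n) by rewrite divr_gt0 // mulr_gt0 // exprn_gt0.
pose rho := 1 - c / (A * 4 ^+ n).
have main x r : 0 < r -> wball x r <= rho * wball x (4 * r).
  move=> r0; have r4 : 0 < 4 * r by rewrite mulr_gt0.
  pose e : 'rV[R]_n := delta_mx ord0 (Ordinal n0).
  have e1 : enorm e = 1.
    rewrite /enorm (bigD1 (Ordinal n0)) //= big1 => [|i /negbTE i0].
      by rewrite mxE !eqxx expr1n addr0 sqrtr1.
    by rewrite mxE eqxx i0 expr0n.
  pose x' := x + (2 * r) *: e.
  have x'x : enorm (x' - x) = 2 * r.
    by rewrite /x' addrC addKr enormZ ?e1 ?mulr1 // mulr_ge0 // ltW.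
  have sub' : eball x' r `<=` eball x (4 * r) by apply: subset_eball; lra.
  have sub : eball x r `<=` eball x (4 * r) by apply: le_eball; lra.
  have := doubling r4 r0 sub'; rewrite exprMn => W'.
  have rn : 0 < r ^+ n by rewrite exprn_gt0.
  have {}W' : c * wball x (4 * r) <= A * 4 ^+ n * wball x' r.
    by rewrite -(ler_pM2r rn); lra.
  have disj : [disjoint eball x r & eball x' r].
    apply/disj_setPS => z []; rewrite /eball /= => zx zx'.
    have := enormD (x' - z) (z - x); rewrite addrA subrK x'x enormB; lra.
  have mB := measurable_eball x r; have mB' := measurable_eball x' r.
  have : wball x r + wball x' r <= wball x (4 * r).
    have mU := measurableU _ _ mB mB'.
    have additive : weight_meas v (eball x r `|` eball x' r) =
        (wball x r + wball x' r)%:E.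
      apply: etrans (congr2 adde (wballE x r0) (wballE x' r0)).
      apply: (ge0_integral_setU mu mB mB' _ _ disj).
        by apply/measurable_EFinP; exact: measurable_funS mv.
      by move=> z _; rewrite lee_fin.
    rewrite -lee_fin -additive; apply: (weight_meas_sub_fin r4 mU).
    by rewrite subUset.
  move=> Wsum; have share : c / (A * 4 ^+ n) * wball x (4 * r) <= wball x' r.
    by rewrite mulrAC ler_pdivrMr ?mulr_gt0 ?exprn_gt0 // [leRHS]mulrC.
  by rewrite /rho mulrBl mul1r lerBrDr; apply: le_trans Wsum; rewrite lerD2l.
have W0 := main 0 1 ltr01; have := wball_gt0 0 ltr01.
move=> /lt_le_trans /(_ W0); rewrite mulr1 pmulr_lgt0 ?wball_gt0 // => rho0.
by exists rho => //; rewrite rho0 /rho; lra.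
Qed.

End A1_weights.

(** * Domination of integrals by series *)

Section countable_domination.
Context (R : realType).

Lemma nneseries_term_le (u : nat -> \bar R) k : (forall i, (0 <= u i)%E) ->
  (u k <= \sum_(0 <= i <oo) u i)%E.
Proof.
move=> u0; rewrite (nneseriesD1 (n := k)) // leeDl //.
by apply: nneseries_ge0 => i _ _.
Qed.

Lemma nneseries_geometric (a z : R) : 0 < z < 1 ->
  (\sum_(0 <= k <oo) (a * z ^+ k)%:E = (a / (1 - z))%:E)%E.
Proof.
move=> /andP[z0 z1].
have nz1 : `|z| < 1 by rewrite ger0_norm // ltW.
have -> : (fun N => \sum_(0 <= k < N) (a * z ^+ k)%:E)%E =
    EFin \o series (geometric a z).
  by apply/funext => N; rewrite /series /= sumEFin.
rewrite EFin_lim; last exact: is_cvg_geometric_series.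
by congr EFin; apply: cvg_lim => //; exact: cvg_geometric_series.
Qed.

(** The form in which an integral is split over annuli: it is enough to bound
    the integrand at each point by the term of one set containing the point,
    so the sets need not be disjoint. *)
Lemma ae_integral_le_series d (T : measurableType d)
    (mu : {measure set T -> \bar R}) (g : T -> \bar R) (f : T -> R)
    (a : nat -> R) (B : nat -> set T) :
  (forall x, (0 <= g x)%E) -> measurable_fun setT g ->
  (forall x, 0 <= f x) -> measurable_fun setT f ->
  (forall k, 0 <= a k) -> (forall k, measurable (B k)) ->
  (\forall x \ae mu, g x = 0%E \/ exists2 k, B k x & (g x <= (a k * f x)%:E)%E) ->
  (\int[mu]_x g x <= \sum_(0 <= k <oo) ((a k)%:E * \int[mu]_(x in B k) (f x)%:E))%E.
Proof.
move=> g0 mg f0 mf a0 mB gB.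
pose t k x := ((a k)%:E * ((EFin \o f) \_ (B k)) x)%E.
have fB0 k x : (0 <= ((EFin \o f) \_ (B k)) x)%E.
  by apply: erestrict_ge0 => y _; rewrite lee_fin.
have mfB k : measurable_fun setT ((EFin \o f) \_ (B k)).
  apply/(measurable_restrictT _ (mB k)); apply/measurable_EFinP; exact: measurable_funS mf.
have t0 k x : (0 <= t k x)%E by rewrite mule_ge0 // lee_fin.
have mt k : measurable_fun setT (t k) by exact: measurable_funeM.
have -> : (\sum_(0 <= k <oo) ((a k)%:E * \int[mu]_(x in B k) (f x)%:E) =
    \sum_(0 <= k <oo) \int[mu]_x t k x)%E.
  apply: eq_eseriesr => k _.
  by rewrite [RHS]ge0_integralZl_EFin //; congr (_ * _)%E; exact: integral_mkcond.
rewrite -integral_nneseries //.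
apply: ae_ge0_le_integral => //.
- by move=> x _; apply: nneseries_ge0 => k _ _.
- by apply: ge0_emeasurable_sum => // k _.
- apply: filterS gB => x [->|[k Bk gk]] _.
    by apply: nneseries_ge0 => k _ _.
  apply: (le_trans _ (nneseries_term_le k _)) => //.
  by rewrite /t patchE mem_set //= -EFinM.
Qed.

End countable_domination.

Lemma dyadic_scale (R : realType) (t r : R) : 0 < t -> t < r ->
  exists k : nat, r / 2 ^+ k.+1 <= t < r / 2 ^+ k.
Proof.
move=> t0 tr.
have ex : exists k, r / 2 ^+ k.+1 <= t.
  exists (Num.trunc (r / t)); rewrite ler_pdivrMr ?exprn_gt0 // mulrC -ler_pdivrMr //.
  apply: ltW; apply: (lt_le_trans (truncnS_gt _)).
  by rewrite -natrX ler_nat ltnW // ltn_expl.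
case: (ex_minnP ex) => k rk kmin; exists k; rewrite rk /=.
case: k {rk} kmin => [|k] kmin; first by rewrite expr0 divr1.
by rewrite ltNge; apply/negP => /kmin; rewrite ltnn.
Qed.

(** * The potential of a weight restricted to a set *)

Lemma powR_exprn (R : realType) (x a : R) k : 0 <= x -> (x ^+ k) `^ a = (x `^ a) ^+ k.
Proof.
move=> x0; elim: k => [|k IH]; first by rewrite !expr0 powR1.
by rewrite !exprS powRM ?exprn_ge0 // IH.
Qed.

Lemma powR_invl (R : realType) (x a : R) : 0 <= x -> x^-1 `^ a = (x `^ a)^-1.
Proof. by move=> x0; rewrite -powR_inv1 // -powRrM mulN1r powRN. Qed.

Lemma powR2N_itv01 (R : realType) (a : R) : 0 < a -> 0 < 2 `^ (- a) < 1.
Proof.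
move=> a0; rewrite powR_gt0 //= powRN invf_lt1 ?powR_gt0 //.
have := @gt0_ltr_powR R a a0 1 2; rewrite /= powR1.
by apply; rewrite ?nnegrE // ltr1n.
Qed.

Section kernel.
Context (R : realType) (n : nat) (alpha : R).
Context (alpha_n : 0 < alpha < n%:R).
Implicit Types (x y z : 'rV[R]_n) (r : R).
Local Notation mu := (@lebesgue R n).
Local Notation beta := (n%:R - alpha).

(** With [f] and [g] the projections of a product this is the joint
    measurability of the kernel; with one of them constant, that of its
    sections. *)
Lemma measurable_kernel d (T : measurableType d) (f g : T -> 'rV[R]_n) (h : T -> R) :
  measurable_fun setT f -> measurable_fun setT g -> measurable_fun setT h ->
  measurable_fun setT (fun t => h t / enorm (f t - g t) `^ beta).
Proof.
move=> mf mg mh; apply: measurable_funM => //.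
rewrite [X in measurable_fun _ X](_ : _ = fun t => enorm (f t - g t) `^ (- beta)).
  exact: (measurableT_comp (measurable_powR _) (measurable_enormB mf mg)).
by apply/funext => t; rewrite powRN.
Qed.

Section pointwise.
Context (v : 'rV[R]_n -> R) (K : R) (y : 'rV[R]_n).
Context (mv : measurable_fun setT v) (v0 : forall x, 0 <= v x) (K0 : 0 <= K).
Context (vy : forall r, 0 < r -> (weight_meas v (eball y r) <= (K * r ^+ n * v y)%:E)%E).

Let kern x := (v x / enorm (x - y) `^ beta)%:E.

Let mkern : measurable_fun setT kern.
Proof. by apply/measurable_EFinP; apply: measurable_kernel. Qed.

Let kern_ge0 x : (0 <= kern x)%E.
Proof. by rewrite lee_fin divr_ge0 // powR_ge0. Qed.

(** On the annulus [r / 2^(k+1) <= |x - y| < r / 2^k] the kernel is at most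
    [(r / 2^(k+1))^(-beta)] and the mass is at most [K * (r / 2^k)^n * v y]; the
    products decrease like [2^(- k alpha)].  At [x = y] the integrand is 0. *)
Lemma kernel_near r : 0 < r ->
  (\int[mu]_(x in eball y r) kern x <=
   (K * 2 `^ beta / (1 - 2 `^ (- alpha)) * r `^ alpha * v y)%:E)%E.
Proof.
move=> r0; have /andP[al0 aln] := alpha_n.
have b0 : 0 < beta by rewrite subr_gt0.
have z01 := powR2N_itv01 al0.
rewrite integral_mkcond.
have mB k : measurable (eball y (r / 2 ^+ k)) by exact: measurable_eball.
pose a k := ((r / 2 ^+ k.+1) `^ beta)^-1.
have a0 k : 0 <= a k by rewrite invr_ge0 powR_ge0.
have scale_gt0 k : 0 < r / 2 ^+ k by rewrite divr_gt0 // exprn_gt0.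
apply: le_trans (@ae_integral_le_series R _ _ mu _ v a
  (fun k => eball y (r / 2 ^+ k)) _ _ v0 mv a0 mB _) _.
- by move=> x; apply: erestrict_ge0.
- apply/(measurable_restrictT _ (measurable_eball y r)); exact: measurable_funS mkern.
- apply: aeW => x; rewrite patchE; case: ifPn => [|_]; last by left.
  rewrite inE /eball /= => xy; have [/eqP xy0|xy0] := boolP (enorm (x - y) == 0).
    by left; rewrite /kern xy0 powR0 ?invr0 ?mulr0 // gt_eqF.
  have xyp : 0 < enorm (x - y) by rewrite lt_neqAle eq_sym xy0 enorm_ge0.
  have [k /andP[k1 k2]] := dyadic_scale xyp xy.
  right; exists k => //; rewrite lee_fin mulrC ler_wpM2r //.
  rewrite lef_pV2 ?posrE ?powR_gt0 //.
  by apply: (ge0_ler_powR (ltW b0)) => //; rewrite nnegrE ltW.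
apply: (@le_trans _ _ (\sum_(0 <= k <oo)
   (K * 2 `^ beta * r `^ alpha * v y * (2 `^ (- alpha)) ^+ k)%:E)%E).
  apply: lee_nneseries => k _.
    by rewrite mule_ge0 ?lee_fin // weight_meas_ge0.
  apply: (le_trans (lee_wpmul2l _ (vy (scale_gt0 k)))); first by rewrite lee_fin.
  rewrite -EFinM lee_fin le_eqVlt; apply/orP; left; apply/eqP.
  have rho0 := scale_gt0 k; have rho0' := ltW rho0.
  have -> : K * 2 `^ beta * r `^ alpha * v y * (2 `^ (- alpha)) ^+ k =
      K * 2 `^ beta * ((r / 2 ^+ k) `^ alpha * v y).
    rewrite -!(mulrA (K * _)); congr (_ * _).
    rewrite powRM ?invr_ge0 ?exprn_ge0 ?(ltW r0) // powR_invl ?exprn_ge0 //.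
    by rewrite powR_exprn // powRN exprVn mulrAC.
  have -> : a k = 2 `^ beta / (r / 2 ^+ k) `^ beta.
    rewrite /a exprSr invfM mulrA powRM ?invr_ge0 // powR_invl // invfM invrK.
    by rewrite mulrC.
  have -> : (r / 2 ^+ k) ^+ n = (r / 2 ^+ k) `^ beta * (r / 2 ^+ k) `^ alpha.
    by rewrite -powRD ?subrK ?powR_mulrn // (gt_eqF rho0) implybT.
  have : (r / 2 ^+ k) `^ beta != 0 by rewrite gt_eqF // powR_gt0.
  by move=> nz; field.
by rewrite nneseries_geometric // lee_fin; lra.
Qed.

(** The first summand is the sum of the dyadic series of [kernel_near], the 1
    accounts for the points outside the splitting radius. *)
Definition kernel_const : R := K * 2 `^ beta / (1 - 2 `^ (- alpha)) + 1.

(** Inside the ball of radius [r] the potential is of order [r^alpha * v y] by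
    [kernel_near]; outside, it is at most [r^(-beta) * e].  The choice
    [r^n = e / v y] makes both of the order of the claimed bound. *)
Lemma kernel_estimate (E : set 'rV[R]_n) (e : R) : measurable E -> 0 < e ->
  weight_meas v E = e%:E -> 0 < v y ->
  (\int[mu]_(x in E) kern x <=
   (kernel_const * e `^ (alpha / n%:R) * v y `^ (1 - alpha / n%:R))%:E)%E.
Proof.
move=> mE e0 vE vy0; have /andP[al0 aln] := alpha_n.
have b0 : 0 < beta by rewrite subr_gt0.
have n0 : 0 < n%:R :> R by exact: lt_trans aln.
pose s := e / v y; have s0 : 0 < s by rewrite divr_gt0.
pose r := s `^ n%:R^-1; have r0 : 0 < r by rewrite powR_gt0.
have es : e = s * v y by rewrite divfK // gt_eqF.
have target : e `^ (alpha / n%:R) * v y `^ (1 - alpha / n%:R) = s `^ (alpha / n%:R) * v y.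
  rewrite {1}es powRM ?(ltW s0) // -mulrA -powRD.
    by rewrite addrC subrK powRr1.
  by rewrite (gt_eqF vy0) implybT.
have ral : r `^ alpha = s `^ (alpha / n%:R) by rewrite /r -powRrM mulrC.
have rbe : e / r `^ beta = s `^ (alpha / n%:R) * v y.
  rewrite /r -powRrM es mulrAC; congr (_ * _).
  rewrite -{1}(powRr1 (ltW s0)) -powRN -powRD; last by rewrite (gt_eqF s0) implybT.
  by congr powR; field; rewrite gt_eqF.
have mEv : measurable_fun setT ((EFin \o v) \_ E).
  by apply/(measurable_restrictT _ mE)/measurable_EFinP; exact: measurable_funS mv.
have mB := measurable_eball y r.
have mBk : measurable_fun setT (kern \_ (eball y r)).
  by apply/(measurable_restrictT _ mB); exact: measurable_funS mkern.
have Ev0 x : (0 <= ((EFin \o v) \_ E) x)%E by apply: erestrict_ge0 => t _; rewrite lee_fin.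
have Bk0 x : (0 <= (kern \_ (eball y r)) x)%E by apply: erestrict_ge0.
apply: (@le_trans _ _ (\int[mu]_x ((kern \_ (eball y r)) x +
    ((r `^ beta)^-1)%:E * ((EFin \o v) \_ E) x))%E).
  rewrite integral_mkcond; apply: (ge0_le_integral mu measurableT).
  - by move=> x _; apply: erestrict_ge0.
  - by apply/(measurable_restrictT _ mE); exact: measurable_funS mkern.
  - by apply: emeasurable_funD; [exact: mBk | exact: measurable_funeM].
  move=> x _; rewrite !patchE; case: (ifPn (x \in E)) => [|_]; last first.
    rewrite mule0 adde0; exact: Bk0.
  case: ifPn => [_ _|].
    by rewrite leeDl // mule_ge0 // lee_fin ?invr_ge0 ?powR_ge0.
  rewrite notin_setE /eball /= => /negP; rewrite -leNgt => rx _.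
  rewrite add0e -EFinM lee_fin mulrC ler_wpM2r //.
  have xp : 0 < enorm (x - y) by exact: lt_le_trans rx.
  rewrite lef_pV2 ?posrE ?powR_gt0 //.
  by apply: (ge0_ler_powR (ltW b0)) => //; rewrite nnegrE ltW.
have rb0 : 0 <= (r `^ beta)^-1 by rewrite invr_ge0 powR_ge0.
have far0 x : (0 <= ((r `^ beta)^-1)%:E * ((EFin \o v) \_ E) x)%E.
  by rewrite mule_ge0 // lee_fin.
rewrite (ge0_integralD mu measurableT (fun x _ => Bk0 x) mBk (fun x _ => far0 x)
  (measurable_funeM _ mEv)).
rewrite (ge0_integralZl_EFin mu measurableT (fun x _ => Ev0 x) mEv rb0).
rewrite -!integral_mkcond -[X in (_ * X)%E]/(weight_meas v E) vE -EFinM [_^-1 * _]mulrC rbe.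
apply: (le_trans (leeD2r _ (kernel_near r0))).
by rewrite -EFinD lee_fin -(mulrA kernel_const) target ral /kernel_const; lra.
Qed.

End pointwise.
End kernel.

(** * The potential of a weight on dyadic shells *)

Lemma quadric_scale (R : realType) (t r : R) : 0 < r ->
  exists j : nat, t < 4 ^+ j.+1 * r /\ ((0 < j)%N -> 4 ^+ j * r <= t).
Proof.
move=> r0.
have ex : exists j, t < 4 ^+ j.+1 * r.
  exists (Num.trunc (t / r)); rewrite -ltr_pdivrMr //.
  apply: (lt_le_trans (truncnS_gt _)).
  by rewrite -natrX ler_nat ltnW // ltn_expl.
case: (ex_minnP ex) => j tj jmin; exists j; split=> //.
case: j {tj} jmin => [//|j] jmin _.
by rewrite leNgt; apply/negP => /jmin; rewrite ltnn.
Qed.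

Section shells.
Context (R : realType) (n : nat) (alpha A : R) (v : 'rV[R]_n -> R).
Context (alpha_n : 0 < alpha < n%:R).
Context (A0 : 0 < A) (mv : measurable_fun setT v) (v0 : forall y, 0 <= v y).
Context (vA : muckenhoupt_A1 A v).
Context (nontrivial : weight_meas v setT != 0%E).
Implicit Types (x y z : 'rV[R]_n) (r : R).
Local Notation mu := (@lebesgue R n).
Local Notation beta := (n%:R - alpha).
Local Notation a := (alpha / n%:R).
Local Notation s := (1 - alpha / n%:R).
Local Notation c := (fine (mu (eball 0 1))).

Let K := A * (n%:R + 2) ^+ n.

(** One summand for the innermost ball, where [K] is the constant of
    [muckenhoupt_centered], and one for all other shells. *)
Definition shell_const : R :=
  kernel_const n alpha K * (A * 4 ^+ n / c) `^ s + 8 `^ beta * A `^ s.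

Let n0 : 0 < n%:R :> R.
Proof. by case/andP: alpha_n => al0; exact: lt_trans. Qed.

Let b0 : 0 < beta.
Proof. by case/andP: alpha_n => _; rewrite subr_gt0. Qed.

Let s0 : 0 < s.
Proof. by rewrite subr_gt0 ltr_pdivrMr // mul1r; case/andP: alpha_n. Qed.

Let K0 : 0 <= K.
Proof. by rewrite mulr_ge0 ?exprn_ge0 ?addr_ge0 // ltW. Qed.

Lemma kernel_const_ge0 : 0 <= kernel_const n alpha K.
Proof.
have /andP[al0 _] := alpha_n.
rewrite /kernel_const addr_ge0 // divr_ge0 //; first by rewrite mulr_ge0 ?powR_ge0.
by rewrite subr_ge0 ltW //; case/andP: (powR2N_itv01 al0).
Qed.

Lemma kernel_far (E : set 'rV[R]_n) (e d : R) y : measurable E -> 0 < d ->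
  weight_meas v E = e%:E -> (forall x, E x -> d <= enorm (x - y)) ->
  (\int[mu]_(x in E) (v x / enorm (x - y) `^ beta)%:E <= (e / d `^ beta)%:E)%E.
Proof.
move=> mE d0 Ee Ed; rewrite mulrC EFinM -Ee /weight_meas -ge0_integralZl_EFin //.
- apply: (ge0_le_integral mu mE).
  + by move=> x _; rewrite lee_fin divr_ge0 // powR_ge0.
  + apply/measurable_EFinP.
    apply: (measurable_funS measurableT (@subsetT _ _)).
    by apply: measurable_kernel; [exact: measurable_id | exact: measurable_cst |].
  + apply: measurable_funeM; apply/measurable_EFinP; exact: measurable_funS mv.
  move=> x Ex; rewrite -EFinM lee_fin mulrC ler_wpM2r //.
  have xp : 0 < enorm (x - y) by apply: lt_le_trans (Ed _ Ex).
  rewrite lef_pV2 ?posrE ?powR_gt0 //.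
  by apply: (ge0_ler_powR (ltW b0)); rewrite ?nnegrE ?(ltW d0) ?(ltW xp) // Ed.
- by move=> x _; rewrite lee_fin.
- by apply/measurable_EFinP; exact: measurable_funS mv.
- by rewrite invr_ge0 powR_ge0.
Qed.

(** If [j = 0] the bound is [kernel_estimate], the ratio of masses being
    bounded below by doubling.  If [j > 0] the least choice of [j] keeps [y] at
    distance at least [4^(j+1) r / 8] from [E], so [kernel_far] applies, and the
    [A_1] condition on the [j]-th ball compares the radius with the masses. *)
Lemma kernel_shells x0 r (E : set 'rV[R]_n) (e : R) : 0 < r -> measurable E ->
  E `<=` eball x0 r -> 0 < e -> weight_meas v E = e%:E ->
  \forall y \ae mu, exists2 j : nat, eball x0 (4 ^+ j.+1 * r) y &
    (\int[mu]_(x in E) (v x / enorm (x - y) `^ beta)%:E <=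
     (shell_const * e `^ a * (wball v x0 r / wball v x0 (4 ^+ j.+1 * r)) `^ s *
      v y `^ s)%:E)%E.
Proof.
move=> r0 mE EB e0 Ee.
have V0 x t : 0 < t -> 0 < wball v x t by exact: wball_gt0 A0 mv v0 vA nontrivial _ _.
have c0 : 0 < c := unit_ball_gt0 mv v0 vA nontrivial.
have R0 j : 0 < 4 ^+ j * r by rewrite mulr_gt0 // exprn_gt0.
have all_shells : \forall y \ae mu, forall j : nat, eball x0 (4 ^+ j.+1 * r) y ->
    wball v x0 (4 ^+ j.+1 * r) <= A * (4 ^+ j.+1 * r) ^+ n * v y.
  apply: ae_foralln => j; apply: filterS (vA x0 (R0 j.+1)) => y /[apply].
  by rewrite (wballE mv v0 vA) // lee_fin.
apply: (filterS2 _ _ all_shells (muckenhoupt_centered A0 mv v0 vA)) => y yshell ycent.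
have vy0 : 0 < v y.
  rewrite lt_neqAle v0 andbT eq_sym; apply/eqP => vy0.
  by have := lt_le_trans (V0 y 1 ltr01) (ycent 1 ltr01); rewrite vy0 mulr0 ltxx.
have [j [yj jfar]] := quadric_scale (enorm (y - x0)) r0.
exists j => //; set W := wball v x0 r; set Wj := wball v x0 _.
have W0 : 0 < W by exact: V0.
have Wj0 : 0 < Wj by exact: V0.
have ea0 := powR_ge0 e a; have vs0 := powR_ge0 (v y) s.
have ws0 := powR_ge0 (W / Wj) s.
case: j yj jfar @Wj Wj0 ws0 => [|j] yj jfar Wj Wj0 ws0.
  have vyK t : 0 < t -> (weight_meas v (eball y t) <= (K * t ^+ n * v y)%:E)%E.
    by move=> t0; rewrite (wballE mv v0 vA) // lee_fin; exact: ycent.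
  apply: (le_trans (kernel_estimate alpha_n mv v0 vyK mE e0 Ee vy0)).
  rewrite lee_fin ler_wpM2r // mulrAC ler_wpM2r //.
  apply: (@le_trans _ _ (kernel_const n alpha K * ((A * 4 ^+ n / c) `^ s * (W / Wj) `^ s))).
    rewrite ler_peMr ?kernel_const_ge0 // -powRM; last 2 first.
    - by rewrite divr_ge0 ?mulr_ge0 ?exprn_ge0 ?(ltW A0) ?(ltW c0).
    - by rewrite divr_ge0 // ltW.
    have D1 : 1 <= A * 4 ^+ n / c * (W / Wj).
      rewrite mulrA ler_pdivlMr // mul1r /Wj expr1.
      exact: (doubling4 A0 mv v0 vA nontrivial x0 r0).
    by have := @ge0_ler_powR R s (ltW s0) 1 _ _ _ D1; rewrite /= powR1; apply;
      rewrite ?nnegrE // (le_trans _ D1).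
  by rewrite mulrA ler_wpM2r // lerDl mulr_ge0 // powR_ge0.
set r' := 4 ^+ j.+2 * r in yj Wj Wj0 ws0 *.
have r'0 : 0 < r' by exact: R0.
have far x : E x -> r' / 8 <= enorm (x - y).
  move=> /EB; rewrite /eball /= => xx0; have := enormD (y - x) (x - x0).
  rewrite addrA subrK (enormB y x) => tri.
  have := jfar isT; have : 4 * r <= 4 ^+ j.+1 * r.
    by rewrite ler_pM2r // exprS ler_peMr // exprn_ege1 // ler1n.
  rewrite /r' (exprS _ j.+1); lra.
have r'8 : 0 < r' / 8 by rewrite divr_gt0.
apply: (le_trans (kernel_far mE r'8 Ee far)); rewrite lee_fin.
have {}yshell : (Wj / (A * v y)) `^ s <= r' `^ beta.
  have -> : r' `^ beta = (r' ^+ n) `^ s.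
    by rewrite -powR_mulrn ?ltW // -powRrM; congr powR; field; rewrite gt_eqF.
  apply: (ge0_ler_powR (ltW s0)); rewrite ?nnegrE.
  - by rewrite divr_ge0 ?mulr_ge0 // ltW.
  - by rewrite exprn_ge0 // ltW.
  - rewrite ler_pdivrMr ?mulr_gt0 //; have := yshell _ yj; rewrite -/r' -/Wj; lra.
(* As E is contained in the ball, e = e^a e^s <= e^a W^s. *)
have eW : e <= e `^ a * W `^ s.
  have {1}-> : e = e `^ a * e `^ s.
    by rewrite -powRD ?(gt_eqF e0) ?implybT // addrC subrK powRr1 // ltW.
  rewrite ler_wpM2l //; apply: (ge0_ler_powR (ltW s0)); rewrite ?nnegrE ?(ltW e0) ?(ltW W0) //.
  by rewrite -lee_fin -Ee; exact: (weight_meas_sub_fin mv v0 vA r0 mE EB).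
apply: (@le_trans _ _ (e `^ a * W `^ s * (8 `^ beta * (A `^ s * v y `^ s / Wj `^ s)))).
  apply: ler_pM => //; first exact: ltW.
    by rewrite invr_ge0 powR_ge0.
  rewrite powRM ?invr_ge0 ?(ltW r'0) // powR_invl // invfM invrK mulrC ler_pM2l ?powR_gt0 //.
  have rb0 : 0 < r' `^ beta by exact: powR_gt0.
  have t0 : 0 < A `^ s * v y `^ s / Wj `^ s by rewrite !(mulr_gt0, invr_gt0, powR_gt0).
  rewrite -[leRHS]invrK lef_pV2 ?posrE ?invr_gt0 //.
  apply: le_trans yshell; rewrite invf_div powRM ?invr_ge0 ?mulr_ge0 ?(ltW Wj0) ?(ltW A0) //.
  by rewrite powR_invl ?mulr_ge0 ?(ltW A0) // powRM // ltW.
have -> : (W / Wj) `^ s = W `^ s / Wj `^ s.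
  by rewrite powRM ?invr_ge0 ?(ltW Wj0) ?(ltW W0) // powR_invl // ltW.
rewrite /shell_const; move: (kernel_const _ _ _) kernel_const_ge0 => kc kc0.
rewrite !mulrDl; set lhs := (X in X <= _); set t1 := (X in _ <= X + _).
have -> : lhs = 8 `^ beta * A `^ s * e `^ a * (W `^ s / Wj `^ s) * v y `^ s.
  rewrite /lhs; move: (e `^ a) (W `^ s) (8 `^ beta) (A `^ s) (v y `^ s) (Wj `^ s)^-1.
  by move=> t2 t3 t4 t5 t6 t7; ring.
by rewrite lerDr /t1; do !apply: mulr_ge0 => //; rewrite ?invr_ge0 powR_ge0.
Qed.

End shells.

(** * Duality for the Riesz potential *)

Section riesz.
Context (R : realType) (n : nat) (alpha : R).
Implicit Types (x y z : 'rV[R]_n) (f v : 'rV[R]_n -> R).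
Local Notation mu := (@lebesgue R n).
Local Notation beta := (n%:R - alpha).

Lemma measurable_riesz f : measurable_fun setT f ->
  measurable_fun setT (riesz_potential alpha f).
Proof.
move=> mf; pose h (p : 'rV[R]_n * 'rV[R]_n) := (f p.2 / enorm (p.1 - p.2) `^ beta)%:E.
have mh : measurable_fun setT h.
  apply/measurable_EFinP; apply: measurable_kernel => //.
  exact: (measurableT_comp mf).
apply: measurable_funeM.
rewrite (_ : (fun x => _) = fun x =>
    (\int[mu]_y (h^\+ (x, y)) - \int[mu]_y (h^\- (x, y)))%E); last first.
  apply/funext => x; rewrite [LHS]integralE.
  by congr (_ - _)%E; apply: eq_integral => y _; rewrite ?funeposE ?funenegE.
apply: emeasurable_funB.
  apply: (measurable_fun_fubini_tonelli_F (m2 := mu) (h^\+)%E) => //.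
  exact: measurable_funepos.
apply: (measurable_fun_fubini_tonelli_F (m2 := mu) (h^\-)%E) => //.
exact: measurable_funeneg.
Qed.

(** Tonelli's theorem for [v x * |f y| / |x - y|^beta] on the product of [E] with the
    whole space. *)
Lemma riesz_weak_duality f v (E : set 'rV[R]_n) (sigma : R) :
  measurable_fun setT f -> measurable_fun setT v -> (forall x, 0 <= v x) ->
  measurable E -> 0 <= sigma ->
  (forall x, E x -> (sigma%:E <= `|riesz_potential alpha f x|)%E) ->
  let k y := (\int[mu]_(x in E) (v x / enorm (x - y) `^ beta)%:E)%E in
  measurable_fun setT (fun y => `|f y|%:E * k y)%E /\
  (sigma%:E * weight_meas v E <=
    `|(riesz_gamma n alpha)^-1|%:E * \int[mu]_y (`|f y|%:E * k y))%E.
Proof.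
move=> mf mv v0 mE s0 Es k.
pose vE x := v x * \1_E x.
have vE0 x : 0 <= vE x by rewrite mulr_ge0 // indicE.
have mvE : measurable_fun setT vE by apply: measurable_funM => //; exact: measurable_indic.
pose F (p : 'rV[R]_n * 'rV[R]_n) := (vE p.1 * `|f p.2| / enorm (p.1 - p.2) `^ beta)%:E.
have F0 p : (0 <= F p)%E by rewrite lee_fin !mulr_ge0 ?invr_ge0 ?powR_ge0.
have mF : measurable_fun setT F.
  apply/measurable_EFinP; apply: measurable_kernel => //.
  apply: measurable_funM; first exact: (measurableT_comp mvE).
  by apply: (measurableT_comp _ (measurableT_comp mf _)) => //.
have vEE (g : 'rV[R]_n -> R) :
    (\int[mu]_(x in E) (v x * g x)%:E = \int[mu]_x (vE x * g x)%:E)%E.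
  rewrite integral_mkcond; apply: eq_integral => x _.
  rewrite epatch_indic /= -EFinM /vE; congr EFin; ring.
have kE y : (\int[mu]_x F (x, y) = `|f y|%:E * k y)%E.
  have g0 x : (0 <= (vE x / enorm (x - y) `^ beta)%:E)%E.
    by rewrite lee_fin mulr_ge0 ?invr_ge0 ?powR_ge0.
  have mg : measurable_fun setT (fun x => (vE x / enorm (x - y) `^ beta)%:E).
    apply/measurable_EFinP.
    by apply: measurable_kernel; [exact: measurable_id | exact: measurable_cst |].
  rewrite /k vEE -(ge0_integralZl_EFin mu measurableT (fun x _ => g0 x) mg (normr_ge0 _)).
  by apply: eq_integral => x _; rewrite -EFinM /F /=; congr EFin; ring.
split.
  rewrite [X in measurable_fun _ X](_ : _ = fubini_G mu F); last first.
    by apply/funext => y; rewrite -kE.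
  exact: measurable_fun_fubini_tonelli_G.
pose G x := (\int[mu]_y (`|f y| / enorm (x - y) `^ beta)%:E)%E.
have G0 x : (0 <= G x)%E.
  by apply: integral_ge0 => y _; rewrite lee_fin mulr_ge0 ?invr_ge0 ?powR_ge0.
have mkx x (h : 'rV[R]_n -> R) : measurable_fun setT h ->
    measurable_fun setT (fun y => (h y / enorm (x - y) `^ beta)%:E).
  by move=> mh; apply/measurable_EFinP; apply: measurable_kernel.
have GE x : (\int[mu]_y F (x, y) = (vE x)%:E * G x)%E.
  have g0 y : (0 <= (`|f y| / enorm (x - y) `^ beta)%:E)%E.
    by rewrite lee_fin mulr_ge0 ?invr_ge0 ?powR_ge0.
  have mg := mkx x (fun y => `|f y|) (measurableT_comp (@normr_measurable R setT) mf).
  rewrite /G -(ge0_integralZl_EFin mu measurableT (fun y _ => g0 y) mg (vE0 x)).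
  by apply: eq_integral => y _; rewrite -EFinM /F /=; congr EFin; rewrite mulrA.
have riesz_le x : (`|riesz_potential alpha f x| <=
    `|(riesz_gamma n alpha)^-1|%:E * G x)%E.
  rewrite /riesz_potential abseM /= lee_wpmul2l ?lee_fin //.
  apply: le_trans (le_abse_integral _ measurableT (mkx x f mf)) _.
  rewrite le_eqVlt; apply/orP; left; apply/eqP; apply: eq_integral => y _.
  by rewrite /= normrM normfV (ger0_norm (powR_ge0 _ _)).
have -> : (\int[mu]_y (`|f y|%:E * k y) = \int[mu]_x \int[mu]_y F (x, y))%E.
  rewrite fubini_tonelli //; apply: eq_integral => y _; by rewrite kE.
have -> : weight_meas v E = (\int[mu]_x (vE x)%:E)%E.
  rewrite -[RHS](_ : (\int[mu]_x (vE x * 1)%:E)%E = _); last first.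
    by apply: eq_integral => x _; rewrite mulr1.
  by rewrite -(vEE (fun=> 1)); apply: eq_integral => x _; rewrite mulr1.
rewrite -ge0_integralZl_EFin //; last 2 first.
- by move=> x _; rewrite lee_fin.
- exact/measurable_EFinP.
have mFx := measurable_fun_fubini_tonelli_F (m2 := mu) F mF F0.
have Fx0 x : (0 <= \int[mu]_y F (x, y))%E by apply: integral_ge0.
rewrite -(ge0_integralZl_EFin mu measurableT (fun x _ => Fx0 x) mFx (normr_ge0 _)).
apply: (ge0_le_integral mu measurableT).
- by move=> x _; rewrite mule_ge0 ?lee_fin.
- by apply: measurable_funeM; exact/measurable_EFinP.
- exact: measurable_funeM.
move=> x _; rewrite GE muleCA [leLHS]muleC.
have [Ex|nEx] := pselect (E x); last first.
  by rewrite /vE indicE memNset // mulr0 !mul0e.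
rewrite lee_wpmul2l ?lee_fin //; apply: le_trans (riesz_le x); exact: Es.
Qed.

End riesz.

(** * Summation over the shells *)

Section morrey.
Context (R : realType) (n : nat) (alpha A kappa : R) (v : 'rV[R]_n -> R) (theta : R -> R).
Context (alpha_n : 0 < alpha < n%:R).
Context (A0 : 0 < A) (mv : measurable_fun setT v) (v0 : forall y, 0 <= v y).
Context (vA : muckenhoupt_A1 A v).
Context (nontrivial : weight_meas v setT != 0%E).
Context (thetaD : D_condition kappa theta) (kappas : kappa < 1 - alpha / n%:R).
Implicit Types (x y z : 'rV[R]_n) (r : R).
Local Notation mu := (@lebesgue R n).
Local Notation beta := (n%:R - alpha).
Local Notation a := (alpha / n%:R).
Local Notation s := (1 - alpha / n%:R).

(** The condition on [theta] trades [theta (V B_j)] for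
    [theta (V B) * (V B_j / V B)^kappa]; what is left of the power [s] is
    [s - kappa > 0], to which iterated reverse doubling applies. *)
Lemma D_condition_decay (rho : R) : 0 < rho < 1 ->
  (forall x r, 0 < r -> wball v x r <= rho * wball v x (4 * r)) ->
  exists2 Ct : R, 0 < Ct & forall x r (j : nat), 0 < r ->
    (wball v x r / wball v x (4 ^+ j.+1 * r)) `^ s * theta (wball v x (4 ^+ j.+1 * r)) <=
    Ct * theta (wball v x r) * (rho `^ (s - kappa)) ^+ j.
Proof.
move=> /andP[rho0 rho1] rev; have [/andP[k0 _] theta0 _ [Ct Ct0 thetaC]] := thetaD.
exists Ct => // x r j r0.
have V0 t : 0 < t -> 0 < wball v x t by exact: (wball_gt0 A0 mv v0 vA nontrivial).
have R0 i : 0 < 4 ^+ i * r by rewrite mulr_gt0 // exprn_gt0.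
have iter i : wball v x r <= rho ^+ i * wball v x (4 ^+ i * r).
  elim: i => [|i IH]; first by rewrite !expr0 !mul1r.
  apply: (le_trans IH); rewrite exprSr -mulrA ler_wpM2l ?exprn_ge0 ?(ltW rho0) //.
  by rewrite (exprS 4) -mulrA; exact: rev.
have := iter j.+1; have W0 := V0 _ r0; have := V0 _ (R0 j.+1).
move: (wball v x (4 ^+ j.+1 * r)) (wball v x r) W0 => Wj W W0 Wj0 WWj.
have d0 : 0 < s - kappa by rewrite subr_gt0.
have ratio : W / Wj <= rho ^+ j.+1 by rewrite ler_pdivrMr.
have WltWj : W < Wj.
  apply: (le_lt_trans WWj); rewrite gtr_pMl // exprn_ilt1 ?(ltW rho0) //.
have := thetaC _ _ W0 WltWj; rewrite ler_pdivrMr ?powR_gt0 // => thWj.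
have q0 : 0 < W / Wj by rewrite divr_gt0.
apply: (@le_trans _ _ ((W / Wj) `^ s * (Ct * (theta W / W `^ kappa) * Wj `^ kappa))).
  by rewrite ler_wpM2l // powR_ge0.
have -> : (W / Wj) `^ s * (Ct * (theta W / W `^ kappa) * Wj `^ kappa) =
    Ct * theta W * (W / Wj) `^ (s - kappa).
  rewrite (@powRB _ (W / Wj) s kappa) ?(gt_eqF q0) ?implybT //.
  have -> : (W / Wj) `^ kappa = W `^ kappa / Wj `^ kappa.
    by rewrite powRM ?invr_ge0 ?(ltW W0) ?(ltW Wj0) // powR_invl // ltW.
  field.
  by rewrite !gt_eqF ?powR_gt0.
apply: ler_wpM2l; first by rewrite mulr_ge0 ?(ltW Ct0) // ltW // theta0.
apply: (@le_trans _ _ ((rho ^+ j.+1) `^ (s - kappa))).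
  by apply: (ge0_ler_powR (ltW d0)); rewrite ?nnegrE ?exprn_ge0 // ltW.
rewrite powR_exprn ?(ltW rho0) // exprS ler_piMl ?exprn_ge0 ?powR_ge0 //.
have := @ge0_ler_powR R (s - kappa) (ltW d0) rho 1.
by rewrite /= powR1; apply; rewrite ?nnegrE // ltW.
Qed.

(** Integrates [kernel_shells]: the sets of [ae_integral_le_series] are the balls
    [B_j], on which the Morrey norm controls the integral of [|f| * v^s]. *)
Lemma morrey_kernel_bound : exists2 M : R, 0 < M &
  forall (f : 'rV[R]_n -> R) (N : R), measurable_fun setT f -> 0 <= N ->
  (forall x r, 0 < r -> (\int[mu]_(y in eball x r) (`|f y| * v y `^ s)%:E <=
     (theta (wball v x r) * N)%:E)%E) ->
  forall x0 r (E : set 'rV[R]_n) (e : R), 0 < r -> measurable E ->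
  E `<=` eball x0 r -> 0 < e -> weight_meas v E = e%:E ->
  let g y := (`|f y|%:E * \int[mu]_(x in E) (v x / enorm (x - y) `^ beta)%:E)%E in
  measurable_fun setT g ->
  (\int[mu]_y g y <= (M * e `^ a * theta (wball v x0 r) * N)%:E)%E.
Proof.
have /andP[al0 aln] := alpha_n.
have n0 : (0 < n)%N by rewrite -(ltr_nat R); exact: lt_trans aln.
have [rho rho01 rev] := reverse_doubling A0 mv v0 vA nontrivial n0.
have [Ct Ct0 decay] := D_condition_decay rho01 rev.
have d0 : 0 < s - kappa by rewrite subr_gt0.
have /andP[rho0 rho1] := rho01.
pose z := rho `^ (s - kappa).
have z01 : 0 < z < 1.
  rewrite powR_gt0 //=; have := @gt0_ltr_powR R (s - kappa) d0 rho 1.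
  by rewrite /= powR1; apply; rewrite ?nnegrE // ltW.
pose S := shell_const n alpha A; have S0 : 0 <= S.
  by rewrite addr_ge0 ?mulr_ge0 ?powR_ge0 ?kernel_const_ge0.
have z1 : 0 < 1 - z by rewrite subr_gt0; case/andP: z01.
exists (S * Ct / (1 - z) + 1).
  by rewrite ltr_wpDl // divr_ge0 ?(ltW z1) // mulr_ge0 // ltW.
move=> f N mf N0 fN x0 r E e r0 mE EB e0 Ee g mg.
have V0 x t : 0 < t -> 0 < wball v x t by exact: (wball_gt0 A0 mv v0 vA nontrivial).
have R0 j : 0 < 4 ^+ j * r by rewrite mulr_gt0 // exprn_gt0.
have [_ theta0 _ _] := thetaD.
have tW := theta0 _ (V0 x0 r r0); have ea0 := powR_ge0 e a.
pose b j := S * e `^ a * (wball v x0 r / wball v x0 (4 ^+ j.+1 * r)) `^ s.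
have b0 j : 0 <= b j by rewrite !mulr_ge0 // powR_ge0.
apply: le_trans (@ae_integral_le_series R _ _ mu g (fun y => `|f y| * v y `^ s) b
  (fun j => eball x0 (4 ^+ j.+1 * r)) _ mg _ _ b0 _ _) _.
- move=> y; rewrite mule_ge0 ?lee_fin //; apply: integral_ge0 => x _.
  by rewrite lee_fin divr_ge0 // powR_ge0.
- by move=> y; rewrite mulr_ge0 // powR_ge0.
- by apply: measurable_funM; [exact: measurableT_comp | exact: measurable_fpow].
- by move=> j; exact: measurable_eball.
- have := kernel_shells alpha_n A0 mv v0 vA nontrivial r0 mE EB e0 Ee.
  apply: filterS => y [j yj kj]; right; exists j => //.
  rewrite /g mulrCA EFinM lee_wpmul2l ?lee_fin //.
apply: (@le_trans _ _ (\sum_(0 <= j <oo)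
    (S * e `^ a * (Ct * theta (wball v x0 r)) * N * z ^+ j)%:E)%E).
  apply: lee_nneseries => j _.
    rewrite mule_ge0 ?lee_fin //; apply: integral_ge0 => y _.
    by rewrite lee_fin mulr_ge0 // powR_ge0.
  apply: (le_trans (lee_wpmul2l _ (fN x0 _ (R0 j.+1)))); first by rewrite lee_fin.
  rewrite -EFinM lee_fin /b.
  have := decay x0 r j r0; rewrite -/z => /(ler_wpM2l (mulr_ge0 S0 ea0)) /(ler_wpM2r N0).
  lra.
rewrite nneseries_geometric // lee_fin.
have : 0 <= e `^ a * theta (wball v x0 r) * N by rewrite !mulr_ge0 // ltW.
have -> : S * e `^ a * (Ct * theta (wball v x0 r)) * N / (1 - z) =
   S * Ct / (1 - z) * (e `^ a * theta (wball v x0 r) * N) by field; rewrite gt_eqF.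
lra.
Qed.

End morrey.

(** * The weak-type estimate *)

Section norms.
Context (R : realType) (n : nat) (theta : R -> R) (u v f : 'rV[R]_n -> R).
Local Notation mu := (@lebesgue R n).

Lemma morrey_norm_ge0 : (0 <= morrey_norm 1 theta v u f)%E.
Proof.
apply: (@le_trans _ _ (((theta (fine (weight_meas u (eball 0 1))))^-1%:E *
  \int[mu]_(x in eball 0 1) (`|f x| `^ 1 * v x)%:E) `^ 1^-1)%E).
  exact: poweR_ge0.
by apply: ereal_sup_ubound; exists 0, 1; split.
Qed.

Lemma morrey_norm_ball x0 r : (forall x, 0 <= v x) -> 0 < r ->
  0 < theta (fine (weight_meas u (eball x0 r))) ->
  (\int[mu]_(x in eball x0 r) (`|f x| * v x)%:E <=
   (theta (fine (weight_meas u (eball x0 r))))%:E * morrey_norm 1 theta v u f)%E.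
Proof.
move=> v0 r0 t0; rewrite -lee_pdivrMl //.
have -> : (\int[mu]_(x in eball x0 r) (`|f x| * v x)%:E =
    \int[mu]_(x in eball x0 r) (`|f x| `^ 1 * v x)%:E)%E.
  by apply: eq_integral => x _; rewrite powRr1.
apply: ereal_sup_ubound; exists x0, r; split=> //=.
rewrite invr1 poweRe1 // mule_ge0 ?lee_fin ?invr_ge0 ?(ltW t0) //.
by apply: integral_ge0 => x _; rewrite lee_fin mulr_ge0 // powR_ge0.
Qed.

End norms.

Theorem theorem2p2 (R : realType) (n : nat) (alpha q kappa : R)
    (w : 'rV[R]_n -> R) (theta : R -> R)
    (halpha : 0 < alpha < n%:R)
    (hq : q = n%:R / (n%:R - alpha))
    (hw : A1 q w)
    (htheta : D_condition kappa theta)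
    (hkappa : 0 <= kappa < q^-1) :
  exists2 C : R, 0 < C & forall f : 'rV[R]_n -> R,
    morrey 1 theta w (fpow w q) f ->
    weak_morrey q (fpow theta q) (fpow w q)
      (riesz_potential alpha f) /\
    (weak_morrey_norm q (fpow theta q) (fpow w q)
       (riesz_potential alpha f)
     <= C%:E * morrey_norm 1 theta w (fpow w q) f)%E.
Proof.
have /andP[al0 aln] := halpha; have /andP[k0 kq] := hkappa.
have n0 : 0 < n%:R :> R by exact: lt_trans aln.
have b0 : 0 < n%:R - alpha by rewrite subr_gt0.
have q0 : 0 < q by rewrite hq divr_gt0.
have qs : q^-1 = 1 - alpha / n%:R by rewrite hq invf_div mulrBl divff // gt_eqF.
have [[w0 [mw _]] _] := hw.
have mv : measurable_fun setT (fpow w q) by exact: measurable_fpow.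
have v0 y : 0 <= fpow w q y by exact: powR_ge0.
have [_ theta0 _ _] := htheta.
suff [C C0 HC] : exists2 C : R, 0 < C & forall f : 'rV[R]_n -> R,
    morrey 1 theta w (fpow w q) f ->
    (weak_morrey_norm q (fpow theta q) (fpow w q) (riesz_potential alpha f)
     <= C%:E * morrey_norm 1 theta w (fpow w q) f)%E.
  exists C; first exact: C0.
  move=> f fM; split; last exact: (HC f fM).
  have [mf _ fN] := fM; split; first exact: measurable_riesz.
  apply: (le_lt_trans (HC f fM)); apply: lte_mul_pinfty => //.
  by rewrite lee_fin ltW.
have mset f x0 r sigma : measurable_fun setT f ->
    measurable (eball x0 r `&` [set x | (sigma%:E < `|riesz_potential alpha f x|)%E]).
  move=> mf; apply: measurableI; first exact: measurable_eball.
  have mI := measurableT_comp (@abse_measurable R setT) (measurable_riesz alpha mf).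
  by have := emeasurable_fun_o_infty measurableT mI sigma%:E; rewrite setTI.
(* A1 admits a weight that vanishes almost everywhere, as 0 * +oo = 0 in its
   definition.  All masses are then 0, where theta is not controlled. *)
have [V0|nontrivial] := eqVneq (weight_meas (fpow w q) setT) 0%E.
  exists 1 => // f [mf _ _]; rewrite mul1e.
  apply: (@le_trans _ _ 0%E); last exact: morrey_norm_ge0.
  apply: ge_ereal_sup => _ [x0 [r [sigma [_ _ ->]]]].
  have -> : weight_meas (fpow w q) (eball x0 r `&`
      [set x | (sigma%:E < `|riesz_potential alpha f x|)%E]) = 0%E.
    apply/eqP; rewrite eq_le weight_meas_ge0 // andbT -V0.
    by apply: le_weight_meas => //; exact: mset.
  by rewrite poweR0r ?mule0 // invr_eq0 gt_eqF.
have [A A0 vA] := A1_muckenhoupt q0 hw.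
have kappas : kappa < 1 - alpha / n%:R by rewrite -qs.
have [M M0 HM] := morrey_kernel_bound halpha A0 mv v0 vA nontrivial htheta kappas.
pose c := `|(riesz_gamma n alpha)^-1|; have c0 : 0 <= c by exact: normr_ge0.
exists (c * M + 1); first by rewrite ltr_wpDl // mulr_ge0 // ltW.
move=> f [mf _ fN]; set N := morrey_norm _ _ _ _ _ in fN *.
have N0 : (0 <= N)%E by exact: morrey_norm_ge0.
have NE : N = (fine N)%:E by rewrite fineK // ge0_fin_numE.
rewrite NE -EFinM; have {}N0 : 0 <= fine N by exact: fine_ge0.
have V0 x t : 0 < t -> 0 < wball (fpow w q) x t.
  exact: (wball_gt0 A0 mv v0 vA nontrivial).
have fball x t : 0 < t -> (\int[@lebesgue R n]_(y in eball x t)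
    (`|f y| * fpow w q y `^ (1 - alpha / n%:R))%:E <=
    (theta (wball (fpow w q) x t) * fine N)%:E)%E.
  move=> t0; rewrite EFinM -NE.
  have := morrey_norm_ball f w0 t0 (theta0 _ (V0 x t t0)); rewrite -/N.
  congr (_ <= _)%E; apply: eq_integral => y _; congr (_ * _)%:E.
  by rewrite /fpow -powRrM -qs mulfV ?gt_eqF // powRr1.
apply: ge_ereal_sup => _ [x0 [r [sigma [r0 sigma0 ->]]]].
set E := _ `&` _; have mE : measurable E by exact: mset.
have EB : E `<=` eball x0 r by apply: subIsetl.
rewrite -/(wball (fpow w q) x0 r).
have tW := theta0 _ (V0 x0 r r0); set tw := theta _ in tW *.
rewrite {1}/fpow -/tw -powRrM mulfV ?gt_eqF // powRr1 ?(ltW tW) //.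
have VEfin := weight_meas_sub_fin mv v0 vA r0 mE EB.
have VE0 : (0 <= weight_meas (fpow w q) E)%E by exact: weight_meas_ge0.
have VEE : weight_meas (fpow w q) E = (fine (weight_meas (fpow w q) E))%:E.
  by rewrite fineK // ge0_fin_numE // (le_lt_trans VEfin) // ltry.
move: VE0; rewrite VEE poweR_EFin -EFinM !lee_fin; set e := fine _ => e0.
rewrite le_eqVlt in e0; have /orP[/eqP <-|{}e0] := e0.
  by rewrite powR0 ?mulr0 ?mulr_ge0 ?addr_ge0 ?mulr_ge0 ?(ltW M0) // invr_eq0 gt_eqF.
have [mg dual] := riesz_weak_duality mf mv v0 mE (ltW sigma0)
  (fun x (Ex : E x) => ltW Ex.2).
have := HM f (fine N) mf N0 fball x0 r E e r0 mE EB e0 VEE mg.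
move=> /(lee_wpmul2l (x := c%:E)); rewrite lee_fin => /(_ c0) /(le_trans dual).
rewrite VEE -!EFinM lee_fin -/e -/tw qs.
have ea0 : 0 < e `^ (alpha / n%:R) by exact: powR_gt0.
have {1}-> : e = e `^ (alpha / n%:R) * e `^ (1 - alpha / n%:R).
  by rewrite -powRD ?(gt_eqF e0) ?implybT // addrC subrK powRr1 // ltW.
move=> bound; rewrite -mulrA mulrC ler_pdivrMr // -(ler_pM2l ea0).
have : 0 <= e `^ (alpha / n%:R) * fine N * tw by rewrite !mulr_ge0 // ltW.
lra.
Qed.
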